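(* Let $\vec p=(\infty,1)$, and let $\vec a,\vec b,\vec c\in\mathbb{R}^2$, $\vec\alpha\in(-1,\infty)^2$. Then the following are equivalent: (1) $S_{\vec a,\vec b,\vec c}$ is bounded from $L^{\vec p}_{\vec\alpha}(T_B\times T_B)$ to $L^\infty(T_B\times T_B)$; (2) $T_{\vec a,\vec b,\vec c}$ is bounded from $L^{\vec p}_{\vec\alpha}(T_B\times T_B)$ to $L^\infty(T_B\times T_B)$; (3) $a_1>0$, $a_2\ge0$, $b_1>-1$, $b_2\ge\alpha_2$, $c_1=n+1+a_1+b_1$, and $c_2=a_2+b_2-\alpha_2$.
   Context: Let $n$ be a positive integer. For $z=(z_1,\dots,z_n)\in\mathbb{C}^n$ write $z=x+iy$ with $x,y\in\mathbb{R}^n$, $z'=(z_1,\dots,z_{n-1})$, $y'=(y_1,\dots,y_{n-1})$. Let $B=\{y\in\mathbb{R}^n: |y'|^2<y_n\}$ and $T_B=\{x+iy: x\in\mathbb{R}^n, y\in B\}$. For $z\in T_B$ put $\rho(z)=y_n-|y'|^2>0$, and for $z,u\in T_B$ put $\rho(z,u)=\frac14\big(\sum_{j=1}^{n-1}(z_j-\overline{u_j})^2-2i(z_n-\overline{u_n})\big)$; this has positive real part, and complex powers $\rho(z,u)^c$ are taken with the principal branch. $dV$ is Lebesgue measure on $\mathbb{C}^n$ and $dV_\alpha(z)=\rho(z)^\alpha dV(z)$. For $\vec p=(p_1,p_2)\in[1,\infty]^2$ and $\vec\alpha=(\alpha_1,\alpha_2)$, $L^{\vec p}_{\vec\alpha}(T_B\times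 T_B)$ is the space of measurable $f$ on $T_B\times T_B$ with finite mixed norm $\|f\|_{\vec p,\vec\alpha}=\big\{\int_{T_B}\big(\int_{T_B}|f(z,w)|^{p_1}dV_{\alpha_1}(z)\big)^{p_2/p_1}dV_{\alpha_2}(w)\big\}^{1/p_2}$, with the inner (resp. outer) integral replaced by an essential supremum in $z$ (resp. $w$) when $p_1=\infty$ (resp. $p_2=\infty$); in particular for $\vec p=(\infty,1)$, $\|f\|=\int_{T_B}\operatorname{ess\,sup}_{z}|f(z,w)|\,dV_{\alpha_2}(w)$. When $\vec p=(\infty,\infty)$ this is $L^\infty(T_B\times T_B)$. For $\vec a=(a_1,a_2),\vec b=(b_1,b_2),\vec c=(c_1,c_2)\in\mathbb{R}^2$, $T_{\vec a,\vec b,\vec c}f(z,w)=\rho(z)^{a_1}\rho(w)^{a_2}\int_{T_B}\int_{T_B}\frac{\rho(u)^{b_1}\rho(\eta)^{b_2}}{\rho(z,u)^{c_1}\rho(w,\eta)^{c_2}}f(u,\eta)\,dV(u)\,dV(\eta)$ and $S_{\vec a,\vec b,\vec c}f(z,w)=\rho(z)^{a_1}\rho(w)^{a_2}\int_{T_B}\int_{T_B}\frac{\rho(u)^{b_1}\rho(\eta)^{b_2}}{|\rho(z,u)|^{c_1}|\rho(w,\eta)|^{c_2}}f(u,\eta)\,dV(u)\,dV(\eta)$. An operator is bounded from $X$ to $Y$ if for every $f\in X$ the defining integral converges for a.e. $(z,w)$ and $\|Tf\|_Y\le C\|f\|_X$ with $C$ independent of $f$. *)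

(* Defs.v *)
From HB Require Import structures.
From mathcomp Require Import all_boot all_order all_algebra.
From mathcomp Require Import all_classical all_reals all_analysis.
From mathcomp Require Import complex.

Unset Printing Implicit Defensive.

Import Order.TTheory GRing.Theory Num.Theory.
Import numFieldNormedType.Exports.

Local Open Scope classical_set_scope.
Local Open Scope ring_scope.

Section TubeDefs.
Context {R : realType}.

Definition RT := measurableTypeR R.

Definition Rn (n : nat) := (n.-tuple RT)%type.

Fixpoint lebn (n : nat) : set (n.-tuple RT) -> \bar R :=
  match n return set (n.-tuple RT) -> \bar R with
  | 0 => fun A => (\1_A [tuple] : R)%:E
  | m.+1 => fun A =>
      (\int[@lebesgue_measure R]_x @lebn m [set t | A (cons_tuple x t)])%E
  end.

(* C^n identified with R^n x R^n via z = x + i y ; a point is the pair (x, y) *)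
Definition Cn (n : nat) := (Rn n * Rn n)%type.

Definition vol (n : nat) : set (Cn n) -> \bar R := (lebn n \x lebn n)%E.

Definition vol2 (n : nat) : set (Cn n * Cn n) -> \bar R := (vol n \x vol n)%E.

(* j-th complex coordinate z_j = x_j + i y_j  (0-based: j = 0, ..., n-1) *)
Definition zc {n : nat} (z : Cn n) (j : nat) : R[i] :=
  Complex (nth 0 (z.1 : seq R) j) (nth 0 (z.2 : seq R) j).

Definition rho {n : nat} (z : Cn n) : R :=
  nth 0 (z.2 : seq R) n.-1 - \sum_(j < n.-1) (nth 0 (z.2 : seq R) j) ^+ 2.

Definition TB (n : nat) : set (Cn n) := [set z | 0 < rho z].

Definition rho2 {n : nat} (z u : Cn n) : R[i] :=
  (Complex 4^-1 0) *
  (\sum_(j < n.-1) (zc z j - conjc (zc u j)) ^+ 2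
   - (Complex 0 2) * (zc z n.-1 - conjc (zc u n.-1))).

Definition cabs (w : R[i]) : R :=
  Num.sqrt (complex.Re w ^+ 2 + complex.Im w ^+ 2).

(* principal argument, with values in (-pi, pi] *)
Definition Arg (w : R[i]) : R :=
  let x := complex.Re w in let y := complex.Im w in
  if 0 < x then atan (y / x)
  else if x < 0 then (if 0 <= y then atan (y / x) + pi else atan (y / x) - pi)
  else if 0 < y then pi / 2 else if y < 0 then - (pi / 2) else 0.

Definition cpow (w : R[i]) (c : R) : R[i] :=
  if w == 0 then 0 else
  Complex (cabs w `^ c * cos (c * Arg w)) (cabs w `^ c * sin (c * Arg w)).

Definition realC (x : R) : R[i] := Complex x 0.

Definition Tkernel {n : nat} (a b c : R * R) (z w u eta : Cn n) : R[i] :=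
  realC (rho z `^ a.1 * rho w `^ a.2 * rho u `^ b.1 * rho eta `^ b.2)
  / (cpow (rho2 z u) c.1 * cpow (rho2 w eta) c.2).

Definition Skernel {n : nat} (a b c : R * R) (z w u eta : Cn n) : R[i] :=
  realC (rho z `^ a.1 * rho w `^ a.2 * rho u `^ b.1 * rho eta `^ b.2
         / (cabs (rho2 z u) `^ c.1 * cabs (rho2 w eta) `^ c.2)).

Definition cintegrable {d} {T : measurableType d} (mu : set T -> \bar R)
    (D : set T) (g : T -> R[i]) :=
  mu.-integrable D (fun x => (complex.Re (g x))%:E) /\
  mu.-integrable D (fun x => (complex.Im (g x))%:E).

Definition cintegral {d} {T : measurableType d} (mu : set T -> \bar R)
    (D : set T) (g : T -> R[i]) : R[i] :=
  Complex (fine (\int[mu]_(x in D) (complex.Re (g x))%:E)%E)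
          (fine (\int[mu]_(x in D) (complex.Im (g x))%:E)%E).

Definition ess_sup_on {d} {T : measurableType d} (mu : set T -> \bar R)
    (D : set T) (g : T -> R) : \bar R :=
  ereal_inf [set y : \bar R | mu.-negligible [set x | D x /\ (y < (g x)%:E)%E]].

Definition volw (n : nat) (alpha : R) : set (Cn n) -> \bar R :=
  fun A => (\int[vol n]_(z in A `&` TB n) (rho z `^ alpha)%:E)%E.

Definition mixnorm_inf1 (n : nat) (alpha : R * R) (f : Cn n * Cn n -> R[i])
  : \bar R :=
  (\int[vol n]_(w in TB n)
     (ess_sup_on (volw n alpha.1) (TB n) (fun z => cabs (f (z, w)))
      * (rho w `^ alpha.2)%:E))%E.

Definition kop {n : nat} (K : Cn n -> Cn n -> Cn n -> Cn n -> R[i])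
    (f : Cn n * Cn n -> R[i]) (zw : Cn n * Cn n) : R[i] :=
  cintegral (vol2 n) (TB n `*` TB n) (fun ue => K zw.1 zw.2 ue.1 ue.2 * f ue).

Definition bounded_inf1_to_inf (n : nat) (alpha : R * R)
    (K : Cn n -> Cn n -> Cn n -> Cn n -> R[i]) : Prop :=
  exists C : R, forall f : Cn n * Cn n -> R[i],
    measurable_fun (TB n `*` TB n) (fun p => complex.Re (f p)) ->
    measurable_fun (TB n `*` TB n) (fun p => complex.Im (f p)) ->
    (mixnorm_inf1 n alpha f < +oo)%E ->
    (vol2 n).-negligible [set zw | (TB n `*` TB n) zw /\
       ~ cintegrable (vol2 n) (TB n `*` TB n)
           (fun ue => K zw.1 zw.2 ue.1 ue.2 * f ue)] /\
    (ess_sup_on (vol2 n) (TB n `*` TB n) (fun zw => cabs (kop K f zw))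
       <= C%:E * mixnorm_inf1 n alpha f)%E.

End TubeDefs.

(* Main.v *)
(* Writing u = s + i v, the real part of rho(z,u) is
     (|x'-s'|^2 + |y'-v'|^2 + 2 rho(z) + 2 rho(u)) / 4,
   so |rho(z,u)| dominates (rho(z) + rho(u)) / 2.

   (3) => (1), (2): both kernels have the same modulus. For fixed eta, bound |f|
   by its essential supremum in u and integrate the kernel in u; the
   Forelli-Rudin estimate
     int rho(u)^b |rho(z,u)|^-c dV(u) <= C rho(z)^(n+1+b-c)
   (b > -1, c > n+1+b) cancels rho(z)^a1. It follows by summing over the dyadic
   boxes |rho(z,u)| ~ 2^k rho(z), rho(u) ~ 2^(k-l) rho(z), whose volumes are
   explicit. The remaining factor rho(w)^a2 rho(eta)^(b2-alpha2) |rho(w,eta)|^-c2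
   is bounded because its exponents are nonnegative and balanced.

   (1) or (2) => (3): test on indicators of boxes so flat that rho(z,u) and
   rho(w,eta) are nearly real there; then even the oscillating kernel has real
   part at least half its modulus, on a set of (z,w) of positive measure. Letting
   the box sizes tend to 0 or infinity gives the conditions on the exponents; the
   strict ones (a1 > 0, b1 > -1) come from unions of dyadic boxes. *)

Require Import Defs.
From HB Require Import structures.
From mathcomp Require Import all_boot all_order all_algebra.
From mathcomp Require Import all_classical all_reals all_analysis.
From mathcomp Require Import measurable_realfun.
From mathcomp Require Import complex ring lra.

Set Implicit Arguments.
Unset Strict Implicit.
Unset Printing Implicit Defensive.

Import Order.TTheory GRing.Theory Num.Theory.
Import numFieldNormedType.Exports.
Local Open Scope classical_set_scope.
Local Open Scope ring_scope.

(** * Lebesgue measure on tuples *)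

(* A name for the product measure: on [m1 \x m2] itself, canonical-structure
   inference finds the instance for subprobabilities only. *)
Section SigmaFiniteProduct.
Local Open Scope ereal_scope.
Context {d1 d2} {T1 : measurableType d1} {T2 : measurableType d2} {R : realType}.
Variable m1 : {sigma_finite_measure set T1 -> \bar R}.
Variable m2 : {sigma_finite_measure set T2 -> \bar R}.

Definition prod_measure : set (T1 * T2) -> \bar R := m1 \x m2.

HB.instance Definition _ := Measure.on prod_measure.

Let prod_measure_sigma_finite : sigma_finite setT prod_measure.
Proof.
have [F TF Foo] := sigma_finiteT m1.
have [G TG Goo] := sigma_finiteT m2.
(* [nk] enumerates all pairs of indices; a number coding no pair defaults to [(0, 0)], which only
   repeats a rectangle. *)
pose nk (i : nat) : nat * nat := odflt (0, 0)%N (unpickle i).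
exists (fun i => F (nk i).1 `*` G (nk i).2).
  apply/seteqP; split => // -[x y] _.
  have [k _ Fkx] : (\bigcup_k F k) x by rewrite -TF.
  have [l _ Gly] : (\bigcup_k G k) y by rewrite -TG.
  by exists (pickle (k, l)) => //; rewrite /nk pickleK.
move=> i; have [mF Fi] := Foo (nk i).1; have [mG Gi] := Goo (nk i).2.
split; first exact: measurableX.
by rewrite /prod_measure product_measure1E// lte_mul_pinfty// ge0_fin_numE.
Qed.

HB.instance Definition _ := Measure_isSigmaFinite.Build _ _ _ prod_measure
  prod_measure_sigma_finite.

End SigmaFiniteProduct.

Section LebesgueTuple.
Context {R : realType}.
Local Notation RT := (@RT R).

Definition cons_pair m (p : RT * m.-tuple RT) : m.+1.-tuple RT :=
  cons_tuple p.1 p.2.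

Lemma measurable_cons_pair m : measurable_fun setT (@cons_pair m).
Proof. exact: measurable_cons. Qed.

Lemma nth_measurable n j :
  measurable_fun setT (fun t : n.-tuple RT => nth 0 (t : seq R) j : R).
Proof.
have [jn|nj] := ltnP j n; last first.
  rewrite (_ : (fun t => _) = cst 0); first exact: measurable_cst.
  by apply/funext => t; rewrite nth_default// size_tuple.
rewrite (_ : (fun t => _) = (fun t : n.-tuple RT => tnth t (Ordinal jn))).
  exact: measurable_tnth.
by apply/funext => t; rewrite (tnth_nth 0).
Qed.

Section cons_measure.
Variables (m : nat) (mu : {sigma_finite_measure set (m.-tuple RT) -> \bar R}).
Local Notation leb_mu := (prod_measure (@lebesgue_measure R) mu).

(** The induction step for [lebn]: Lebesgue measure on the head times [mu] on the tail, carried over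
    to tuples. *)
Definition cons_measure := pushforward leb_mu (@cons_pair m).

Let cons_measure0 : cons_measure set0 = 0%E.
Proof. by rewrite /cons_measure /pushforward preimage_set0 measure0. Qed.

Let cons_measure_ge0 A : (0 <= cons_measure A)%E.
Proof. exact: (measure_ge0 leb_mu). Qed.

Let cons_measure_sigma_additive : semi_sigma_additive cons_measure.
Proof.
move=> F mF tF mUF; rewrite /cons_measure /pushforward preimage_bigcup.
have mpre A : measurable A -> measurable (@cons_pair m @^-1` A).
  by move=> mA; rewrite -[X in measurable X]setTI; exact: measurable_cons_pair.
apply: (@measure_semi_sigma_additive _ _ _ leb_mu).
- by move=> k; exact: mpre.
- apply/trivIsetP => /= i j _ _ ij; rewrite -preimage_setI.
  by move/trivIsetP : tF => /(_ _ _ _ _ ij) ->//; rewrite preimage_set0.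
- by rewrite -preimage_bigcup; exact: mpre.
Qed.

HB.instance Definition _ := isMeasure.Build _ _ _ cons_measure
  cons_measure0 cons_measure_ge0 cons_measure_sigma_additive.

Let cons_measure_sigma_finite : sigma_finite setT cons_measure.
Proof.
have [F TF Foo] := sigma_finiteT leb_mu.
(* A cover of the product by sets of finite measure is transported to tuples through this inverse of
   [cons_pair]. *)
pose uncons (t : m.+1.-tuple RT) : RT * m.-tuple RT :=
  (thead t, [tuple of behead t]).
have muncons : measurable_fun setT uncons.
  apply/measurable_fun_pairP; split; last exact: measurable_behead.
  exact: measurable_tnth.
have consK : cancel (@cons_pair m) uncons.
  by case=> x t; rewrite /uncons theadE; congr pair; apply/val_inj.
exists (fun k => uncons @^-1` F k).
  by rewrite -preimage_bigcup -TF preimage_setT.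
move=> k; have [mF Fk] := Foo k; split.
  by rewrite -[X in measurable X]setTI; exact: muncons.
rewrite /cons_measure /pushforward.
by rewrite -comp_preimage (_ : uncons \o _ = id) ?preimage_id//; apply/funext.
Qed.

HB.instance Definition _ := Measure_isSigmaFinite.Build _ _ _ cons_measure
  cons_measure_sigma_finite.

End cons_measure.

(** [lebn] is a bare recursive set function; realizing it as a structured measure, by induction on
    [n], gives access to Tonelli's theorem and to product measures. *)
Lemma lebn_sigma_finite_measure n :
  exists mu : {sigma_finite_measure set (n.-tuple RT) -> \bar R},
    (mu : set (n.-tuple RT) -> \bar R) = lebn n.
Proof.
elim: n => [|m [mu muE]].
  exists (\d_([tuple] : 0.-tuple RT))%R.
  by apply/funext => A.
exists (cons_measure mu).
apply/funext => A /=; rewrite -muE.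
apply: eq_integral => x _ /=; congr (mu _).
by apply/seteqP; split => t; rewrite /xsection/= inE.
Qed.

Definition leb_tuple n : {sigma_finite_measure set (n.-tuple RT) -> \bar R} :=
  sval (cid (lebn_sigma_finite_measure n)).

Lemma leb_tupleE n : lebn n = leb_tuple n.
Proof. by rewrite /leb_tuple; case: cid. Qed.

Lemma lebnS m (A : set (m.+1.-tuple RT)) :
  (lebn m.+1 A =
   \int[@lebesgue_measure R]_x lebn m [set t | A (cons_tuple x t)])%E.
Proof. by []. Qed.

(* The last coordinate is integrated first, which absorbs the translation by
   [phi] of the earlier ones. *)
Definition sheared_box m (p : seq R) (h : R) (phi : seq R -> R) (lo hi : R) :
    set (m.+1.-tuple RT) :=
  [set t | (forall j, (j < m)%N -> `|nth 0 (t : seq R) j - nth 0 p j| <= h) /\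
           lo < nth 0 (t : seq R) m - phi (take m (t : seq R)) <= hi].

(** Induction on [m], slicing along the first coordinate [x]: a slice is either empty or a box of
    the same kind for the shear [phi (x :: s)], whence the generalization over [phi]. In the base
    case a translated interval remains. *)
Lemma lebn_sheared_box m p (h : R) phi lo hi : 0 <= h -> lo <= hi ->
  lebn m.+1 (sheared_box p h phi lo hi) = ((2 * h) ^+ m * (hi - lo))%:E.
Proof.
move=> h0 lohi; elim: m p phi => [|m IH] p phi.
  rewrite expr0 mul1r /=.
  rewrite (eq_integral (fun x : RT =>
      (\1_(`]lo + phi [::], hi + phi [::]]%classic) x)%:E)); last first.
    move=> x _; rewrite !indicE; congr ((_ : bool)%:R%:E).
    apply/idP/idP; rewrite !inE /sheared_box/= in_itv/=.
      by move=> [_ /andP[a b]]; apply/andP; split; lra.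
    by move=> /andP[a b]; split => //; apply/andP; split; lra.
  rewrite integral_indic//= setIT lebesgue_measure_itv/= lte_fin.
  case: ltP => [_|]; first by rewrite -EFinD; congr EFin; ring.
  by move=> le1; congr EFin; lra.
rewrite lebnS.
rewrite (eq_integral (fun x : RT => ((2 * h) ^+ m * (hi - lo))%:E *
   (\1_(`[nth 0 p 0%N - h, nth 0 p 0%N + h]%classic) x)%:E)%E); last first.
  move=> x _; rewrite indicE.
  rewrite (_ : (x \in _) = (nth 0 p 0%N - h <= x <= nth 0 p 0%N + h)); last first.
    by apply/idP/idP; rewrite inE/= in_itv.
  case: (boolP (_ <= x <= _)) => xin.
    rewrite mule1 (_ : mkset _ =
      sheared_box (behead p) h (fun s => phi (x :: s)) lo hi) ?IH//.
    apply/seteqP; split => t [t1 t2]; split=> //.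
      by move=> j jm; rewrite nth_behead; exact: (t1 j.+1).
    case=> [_|j jm]; last by have := t1 j jm; rewrite nth_behead.
    by rewrite /= ler_norml; lra.
  rewrite mule0 (_ : mkset _ = set0); first by rewrite leb_tupleE measure0.
  apply/seteqP; split => // t [/(_ 0%N (ltn0Sn m))/= +].
  by rewrite ler_norml => ?; lra.
rewrite ge0_integralZl//; last 2 first.
- by apply/measurable_EFinP; exact: measurable_indic.
- by rewrite lee_fin mulr_ge0// ?subr_ge0// exprn_ge0// mulr_ge0.
rewrite integral_indic//= setIT lebesgue_measure_itv/= lte_fin.
rewrite exprS; case: ltP => [_|hle]; first by rewrite -EFinD -EFinM; congr EFin; ring.
(* Degenerate interval: its measure is 0, and the right-hand side vanishes because [h = 0]. *)
have -> : h = 0 by lra.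
by rewrite mule0 mulr0 !mul0r.
Qed.

Lemma measurable_sheared_box m p (h : R) phi lo hi :
  measurable_fun setT (fun t : m.+1.-tuple RT => phi (take m (t : seq R))) ->
  measurable (sheared_box p h phi lo hi : set (m.+1.-tuple RT)).
Proof.
move=> mphi.
rewrite (_ : sheared_box _ _ _ _ _ =
  (\bigcap_(j in `I_m) (fun t : m.+1.-tuple RT =>
     `|nth 0 (t : seq R) j - nth 0 p j|) @^-1` `]-oo, h]) `&`
  (fun t : m.+1.-tuple RT => nth 0 (t : seq R) m - phi (take m (t : seq R)))
    @^-1` `]lo, hi]); last first.
  apply/seteqP; split => t.
    move=> [t1 t2]; split; last by rewrite /= in_itv.
    by move=> j jm; rewrite /= in_itv/=; exact: t1.
  move=> [t1]; rewrite /= in_itv/= => t2; split; last by [].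
  by move=> j jm; have := t1 j jm; rewrite /= in_itv.
apply: measurableI; last first.
  rewrite -[X in measurable X]setTI.
  have mB := measurable_funB (@nth_measurable m.+1 m) mphi.
  exact: mB.
apply: bigcap_measurableType => j _; rewrite -[X in measurable X]setTI.
have mn : measurable_fun setT
    (fun t : m.+1.-tuple RT => `|nth 0 (t : seq R) j - nth 0 p j|).
  apply: measurableT_comp => //.
  by have := measurable_funB (@nth_measurable m.+1 j)
    (@measurable_cst _ _ _ _ setT (nth 0 p j)).
exact: mn.
Qed.

End LebesgueTuple.

(** * The function [rho2] and the kernels *)

Section Complex.
Context {R : realType}.
Implicit Types w : R[i].

Lemma cabs_ge0 w : 0 <= cabs w.
Proof. exact: sqrtr_ge0. Qed.

Lemma ler_norm_Re_cabs w : `|complex.Re w| <= cabs w.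
Proof. by rewrite -sqrtr_sqr ler_sqrt ?lerDl ?sqr_ge0// addr_ge0 ?sqr_ge0. Qed.

Lemma ler_norm_Im_cabs w : `|complex.Im w| <= cabs w.
Proof. by rewrite -sqrtr_sqr ler_sqrt ?lerDr ?sqr_ge0// addr_ge0 ?sqr_ge0. Qed.

Lemma cabs_le_norm w : cabs w <= `|complex.Re w| + `|complex.Im w|.
Proof.
rewrite -(ger0_norm (addr_ge0 (normr_ge0 (complex.Re w)) (normr_ge0 (complex.Im w)))).
rewrite -sqrtr_sqr ler_sqrt ?sqr_ge0//.
rewrite -[_ ^+ 2 in leLHS]real_normK ?num_real//.
rewrite -[complex.Im w ^+ 2]real_normK ?num_real//.
have := mulr_ge0 (normr_ge0 (complex.Re w)) (normr_ge0 (complex.Im w)).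
by rewrite sqrrD; lra.
Qed.

Lemma Re_sum I r (P : pred I) (F : I -> R[i]) :
  complex.Re (\sum_(i <- r | P i) F i) = \sum_(i <- r | P i) complex.Re (F i).
Proof. by apply: (big_morph (@complex.Re R)) => // -[a b] [a' b']. Qed.

Lemma Im_sum I r (P : pred I) (F : I -> R[i]) :
  complex.Im (\sum_(i <- r | P i) F i) = \sum_(i <- r | P i) complex.Im (F i).
Proof. by apply: (big_morph (@complex.Im R)) => // -[a b] [a' b']. Qed.

Lemma Re_mul (v w : R[i]) : complex.Re (v * w) =
  complex.Re v * complex.Re w - complex.Im v * complex.Im w.
Proof. by case: v w => [a b] [a' b']. Qed.

Lemma Im_mul (v w : R[i]) : complex.Im (v * w) =
  complex.Re v * complex.Im w + complex.Im v * complex.Re w.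
Proof. by case: v w => [a b] [a' b']. Qed.

End Complex.

(** * Real and imaginary parts of [rho2] *)

Section Geometry.
Context {R : realType} (m : nat).
Local Notation Cn := (@Cn R m.+1).
Implicit Types z u : Cn.

Local Notation xc z j := (nth 0 (z.1 : seq R) j).
Local Notation yc z j := (nth 0 (z.2 : seq R) j).

(** Each square has real part [(x_j - s_j)^2 - (y_j + v_j)^2], where [u = s + i v]. Writing [-(y_j +
    v_j)^2 = (y_j - v_j)^2 - 2 (y_j^2 + v_j^2)], the last terms combine with [2 (y_n + v_n)] into
    [2 (rho z + rho u)]. *)
Lemma rho2_Re z u : complex.Re (rho2 z u) =
  4^-1 * (\sum_(j < m) (xc z j - xc u j) ^+ 2 + \sum_(j < m) (yc z j - yc u j) ^+ 2
          + 2 * (rho z + rho u)).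
Proof.
rewrite /rho2 Re_mul /= mul0r subr0; congr (_ * _).
rewrite [LHS](_ : _ = complex.Re (\sum_(j < m) (zc z j - conjc (zc u j)) ^+ 2) +
  2 * (yc z m + yc u m)); last first.
  case: (\sum_(j < m) _) => p q /=; ring.
rewrite /rho /= Re_sum.
rewrite [X in _ = _ + X](_ : _ = \sum_(j < m) (- 2 * (yc z j ^+ 2 + yc u j ^+ 2))
  + 2 * (yc z m + yc u m)); last first.
  by rewrite -mulr_sumr big_split/=; ring.
rewrite addrA -!big_split; congr (_ + _); apply: eq_bigr => j _.
by rewrite expr2 Re_mul /zc /=; ring.
Qed.

Lemma rho2_Im z u : complex.Im (rho2 z u) =
  2^-1 * (\sum_(j < m) (xc z j - xc u j) * (yc z j + yc u j) - (xc z m - xc u m)).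
Proof.
rewrite /rho2 Im_mul /= mul0r addr0.
rewrite [X in _ * X](_ : _ = complex.Im (\sum_(j < m) (zc z j - conjc (zc u j)) ^+ 2)
  - 2 * (xc z m - xc u m)); last first.
  case: (\sum_(j < m) _) => p q /=; ring.
rewrite Im_sum (_ : \sum_(j < m) complex.Im _ =
  2 * \sum_(j < m) (xc z j - xc u j) * (yc z j + yc u j)); last first.
  rewrite mulr_sumr; apply: eq_bigr => j _.
  by rewrite expr2 Im_mul /zc /=; ring.
by field.
Qed.

Lemma rho2_Re_ge z u : (rho z + rho u) / 2 <= complex.Re (rho2 z u).
Proof.
rewrite rho2_Re.
have h (F : 'I_m -> R) : 0 <= \sum_(j < m) F j ^+ 2.
  by apply: sumr_ge0 => j _; exact: sqr_ge0.
have := h (fun j => xc z j - xc u j); have := h (fun j => yc z j - yc u j).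
move=> /=; lra.
Qed.

Lemma rho2_Re_gt0 z u : TB m.+1 z -> TB m.+1 u -> 0 < complex.Re (rho2 z u).
Proof.
rewrite /TB /= => z0 u0; apply: lt_le_trans (rho2_Re_ge z u).
by rewrite divr_gt0// addr_gt0.
Qed.

Lemma cabs_rho2_ge z u : (rho z + rho u) / 2 <= cabs (rho2 z u).
Proof.
apply: (le_trans (rho2_Re_ge z u)); apply: le_trans (ler_norm_Re_cabs _).
exact: ler_norm.
Qed.

Lemma cabs_rho2_gt0 z u : TB m.+1 z -> TB m.+1 u -> 0 < cabs (rho2 z u).
Proof.
move=> z0 u0; apply: lt_le_trans (cabs_rho2_ge z u).
by rewrite divr_gt0// addr_gt0.
Qed.

End Geometry.

(** * Modulus and phase of the kernels *)

Section Kernels.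
Context {R : realType} (m : nat).
Local Notation Cn := (@Cn R m.+1).
Variables (a b c : R * R).

Definition skernel (z w u eta : Cn) : R :=
  rho z `^ a.1 * rho w `^ a.2 * rho u `^ b.1 * rho eta `^ b.2
  / (cabs (rho2 z u) `^ c.1 * cabs (rho2 w eta) `^ c.2).

(** The argument of the denominator of [Tkernel]: on the tube domain [rho2] has positive real part,
    so its principal argument is an arctangent. *)
Definition kangle (z w u eta : Cn) : R :=
  c.1 * atan (complex.Im (rho2 z u) / complex.Re (rho2 z u)) +
  c.2 * atan (complex.Im (rho2 w eta) / complex.Re (rho2 w eta)).

Lemma SkernelE z w u eta : Skernel a b c z w u eta = Complex (skernel z w u eta) 0.
Proof. by []. Qed.

(** The denominator is a positive modulus times a phase of angle [kangle]; division reverses the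
    angle, hence the minus sign. *)
Lemma TkernelE z w u eta : TB m.+1 z -> TB m.+1 w -> TB m.+1 u -> TB m.+1 eta ->
  Tkernel a b c z w u eta =
  Complex (skernel z w u eta * cos (kangle z w u eta))
          (- (skernel z w u eta * sin (kangle z w u eta))).
Proof.
move=> Tz Tw Tu Te; rewrite /Tkernel.
have Re1 := rho2_Re_gt0 Tz Tu; have Re2 := rho2_Re_gt0 Tw Te.
have nz v : 0 < complex.Re v -> (v == 0 :> R[i]) = false.
  by move=> v0; apply/negP => /eqP v0'; rewrite v0' ltxx in v0.
have ArgE v : 0 < complex.Re v -> Arg v = atan (complex.Im v / complex.Re v).
  by move=> v0; rewrite /Arg v0.
rewrite /cpow !nz// !ArgE// /skernel.
have r1 := powR_gt0 c.1 (cabs_rho2_gt0 Tz Tu).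
have r2 := powR_gt0 c.2 (cabs_rho2_gt0 Tw Te).
rewrite /kangle; set t1 := c.1 * _; set t2 := c.2 * _.
move: r1 r2; set r1 := cabs _ `^ _; set r2 := cabs _ `^ _ => r10 r20.
set k := _ * _ * _ * _; set den := (X in realC _ / X).
have denE : den = Complex (r1 * r2 * cos (t1 + t2)) (r1 * r2 * sin (t1 + t2)).
  by rewrite /den cosD sinD; apply/eqP; rewrite eq_complex/=; apply/andP; split;
    apply/eqP; ring.
have r0 : r1 * r2 != 0 by rewrite mulf_neq0 ?(gt_eqF r10) ?(gt_eqF r20).
have den0 : den != 0.
  rewrite denE eq_complex/=; apply/negP => /andP[/eqP c0 /eqP s0].
  have := cos2Dsin2 (t1 + t2).
  move/eqP: c0; rewrite mulf_eq0 (negbTE r0) => /eqP ->.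
  move/eqP: s0; rewrite mulf_eq0 (negbTE r0) => /eqP ->.
  by rewrite expr0n addr0 => /esym/eqP; rewrite oner_eq0.
(* Multiplying by the denominator leaves a polynomial identity in cosine and sine, with no complex
   inverse to compute. *)
apply: (mulIf den0); rewrite mulfVK// denE.
apply/eqP; rewrite eq_complex/=; apply/andP; split; apply/eqP.
  rewrite (_ : _ - _ = k * (cos (t1 + t2) ^+ 2 + sin (t1 + t2) ^+ 2)).
    by rewrite cos2Dsin2 mulr1.
  by field; rewrite (gt_eqF r10) (gt_eqF r20).
by field; rewrite (gt_eqF r10) (gt_eqF r20).
Qed.

Lemma skernel_ge0 z w u eta : 0 <= skernel z w u eta.
Proof. by rewrite divr_ge0// !mulr_ge0// powR_ge0. Qed.

End Kernels.

(** * Integrals of nonnegative functions *)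

Section LowerIntegral.
Local Open Scope ereal_scope.
Context {d} {T : measurableType d} {R : realType} (mu : {measure set T -> \bar R}).

(* The integral of a nonnegative function is a supremum over the simple
   functions below it, hence monotone without any measurability assumption. *)
Lemma ge0_le_lower_integral (D : set T) (f g : T -> \bar R) :
  (forall x, D x -> 0 <= f x) -> (forall x, D x -> f x <= g x) ->
  \int[mu]_(x in D) f x <= \int[mu]_(x in D) g x.
Proof.
move=> f0 fg.
have g0 x : D x -> 0 <= g x by move=> Dx; exact: le_trans (f0 _ Dx) (fg _ Dx).
rewrite !ge0_integralE//; apply: ereal_sup_le => _ /= [h hf <-].
exists h => // x.
apply: (le_trans (hf x)); rewrite !patchE.
by case: ifPn => // /set_mem; exact: fg.
Qed.

Lemma nneseries_geometric_le (u : nat -> \bar R) (C q : R) :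
  (0 <= C)%R -> (0 < q < 1)%R -> (forall k, 0 <= u k) ->
  (forall k, u k <= (C * q ^+ k)%:E) ->
  \sum_(0 <= k <oo) u k <= (C / (1 - q))%:E.
Proof.
move=> C0 /andP[q0 q1] u0 uC; apply: lime_le; first exact: is_cvg_nneseries.
apply: nearW => k; apply: (@le_trans _ _ (\sum_(0 <= i < k) (C * q ^+ i)%:E)).
  by apply: lee_sum.
rewrite sumEFin lee_fin; apply: geometric_le_lim => //.
by rewrite ger0_norm// ltW.
Qed.

Lemma ge_nneseries_term (u : nat -> \bar R) k : (forall i, 0 <= u i) ->
  u k <= \sum_(0 <= i <oo) u i.
Proof.
move=> u0; apply: le_trans (nneseries_lim_ge k.+1 _) => //.
by rewrite big_nat_recr//= leeDr// sume_ge0.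
Qed.

(** [f] lies below the double series of the functions [M k l] times the indicator of [B k l], since
    each point is in some suitable box; the boxes may overlap. Integrating termwise, the sum over
    [l] gives [1 / (1 - q)] and the sum over [k] gives [1 / (1 - p)]. *)
Lemma integral_le_double_geometric (D : set T) (f : T -> \bar R)
    (B : nat -> nat -> set T) (M : nat -> nat -> R) (C p q : R) :
  measurable D -> (forall k l, measurable (B k l)) ->
  (forall k l, 0 <= M k l)%R -> (0 <= C)%R -> (0 < p < 1)%R -> (0 < q < 1)%R ->
  (forall x, D x -> 0 <= f x) ->
  (forall x, D x -> exists k l, B k l x /\ f x <= (M k l)%:E) ->
  (forall k l, (M k l)%:E * mu (B k l) <= (C * p ^+ k * q ^+ l)%:E) ->
  \int[mu]_(x in D) f x <= (C / (1 - q) / (1 - p))%:E.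
Proof.
move=> mD mB M0 C0 p01 q01 f0 fM MB.
pose g k l x := (M k l)%:E * (\1_(B k l) x)%:E.
have g0 k l x : 0 <= g k l x by rewrite mule_ge0// lee_fin.
have mg k l : measurable_fun D (g k l).
  apply: emeasurable_funM; first exact: measurable_cst.
  by apply/measurable_EFinP; exact: measurable_indic.
have ig k l : \int[mu]_(x in D) g k l x <= (C * p ^+ k * q ^+ l)%:E.
  apply: le_trans (MB k l); rewrite ge0_integralZl ?lee_fin//.
  - rewrite integral_indic// lee_pmul ?lee_fin//.
    by apply: le_measure; rewrite ?inE//; exact: measurableI.
  - by apply/measurable_EFinP; exact: measurable_indic.
have sg0 k x : 0 <= \sum_(0 <= l <oo) g k l x by exact: nneseries_ge0.
apply: (@le_trans _ _ (\int[mu]_(x in D)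
    \sum_(0 <= k <oo) \sum_(0 <= l <oo) g k l x)).
  apply: ge0_le_lower_integral => // x Dx.
  have [k [l [Bx fx]]] := fM x Dx; apply: (le_trans fx).
  apply: le_trans (ge_nneseries_term k (sg0 ^~ x)).
  apply: le_trans (ge_nneseries_term l _) => //.
  by rewrite /g indicE mem_set// mule1.
have [q0 q1] := andP q01; have [p0 p1] := andP p01.
rewrite integral_nneseries//; last first.
  by move=> k; apply: ge0_emeasurable_sum => // l; exact: mg.
apply: nneseries_geometric_le => //.
- by rewrite divr_ge0// subr_ge0 ltW.
- by move=> k; apply: integral_ge0.
move=> k; rewrite integral_nneseries//.
rewrite mulrAC; apply: nneseries_geometric_le => //.
- by rewrite mulr_ge0// exprn_ge0// ltW.
- by move=> l; apply: integral_ge0.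
Qed.

End LowerIntegral.

(** * The Forelli-Rudin estimate *)

Section Powers.
Context {R : realType}.
Implicit Types x y t a : R.

(** [ln x] and [ln t] differ by at most [ln k]; taking [|a|] in the bounds treats both signs of the
    exponent at once. *)
Lemma powR_near (k : R) t x a : 1 <= k -> 0 < t -> t <= k * x -> x <= k * t ->
  k `^ (- `|a|) * t `^ a <= x `^ a <= k `^ `|a| * t `^ a.
Proof.
move=> k1 t0 tx xt.
have k0 : 0 < k by exact: lt_le_trans k1.
have x0 : 0 < x by rewrite -(pmulr_rgt0 _ k0); exact: lt_le_trans tx.
rewrite /powR !gt_eqF// -!expRD !ler_expR.
have : `|a * (ln x - ln t)| <= `|a| * ln k.
  rewrite normrM ler_wpM2l// ler_norml; apply/andP; split.
    rewrite -subr_ge0 opprK addrAC -lnM ?posrE// subr_ge0 ler_ln ?posrE//.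
      by rewrite mulrC.
    exact: mulr_gt0.
  rewrite lerBlDr -lnM ?posrE// ler_ln ?posrE//.
  exact: mulr_gt0.
by rewrite ler_norml mulrBr => /andP[h1 h2]; apply/andP; split; lra.
Qed.

Lemma powR_exprn x a n : 0 <= x -> (x ^+ n) `^ a = (x `^ a) ^+ n.
Proof.
move=> x0; rewrite -(powR_mulrn _ x0) -(powR_mulrn _ (powR_ge0 x a)).
by rewrite -!powRrM mulrC.
Qed.

Lemma powRD_gt0 (x r s : R) : 0 < x -> x `^ (r + s) = x `^ r * x `^ s.
Proof. by move=> x0; rewrite powRD// (gt_eqF x0) implybT. Qed.

Lemma powR2_lt1 (x : R) : x < 0 -> 2 `^ x < 1.
Proof. by move=> x0; rewrite /powR gt_eqF// expR_lt1 pmulr_llt0 ?ln_gt0 ?ltr1n. Qed.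

(** A positive [p] is refuted at [x = (C + 1) ^ (1 / p)], where the bound would read
    [C + 1 <= C]. *)
Lemma powR_bounded_ge1 (p C : R) : (forall x, 1 <= x -> x `^ p <= C) -> p <= 0.
Proof.
move=> h; rewrite leNgt; apply/negP => p0.
have C1 : 1 <= C by have := h 1 (lexx _); rewrite powR1.
have x1 : 1 <= (C + 1) `^ p^-1.
  by rewrite -[leLHS](powRr0 (C + 1)); apply: ler_powR; rewrite ?invr_ge0 ?ltW//; lra.
have := h _ x1; rewrite -powRrM mulVf ?gt_eqF// powRr1; lra.
Qed.

Lemma powR_bounded_le1 (p C : R) : (forall x, 0 < x <= 1 -> x `^ p <= C) -> 0 <= p.
Proof.
move=> h; rewrite -oppr_le0; apply: (@powR_bounded_ge1 _ C) => x x1.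
have x0 : 0 < x by exact: lt_le_trans x1.
have -> : x `^ (- p) = x^-1 `^ p.
  by rewrite -[x^-1]powR_inv1 ?ltW// -powRrM mulN1r.
by apply: h; rewrite invr_gt0 x0 invf_le1.
Qed.

(** The least [k] with [y <= 2 ^+ k * x] works: the upper bound comes from minimality if [k] is
    positive and from the hypothesis if [k] is 0. *)
Lemma dyadic_up x y : 0 < x -> x <= 2 * y ->
  exists k, y <= 2 ^+ k * x <= 2 * y.
Proof.
move=> x0 xy.
have ex : exists k, y <= 2 ^+ k * x.
  have yk := upper_nthrootP (leqnn (Num.bound (y / x))); exists (Num.bound (y / x)).
  by rewrite -ler_pdivrMr// ltW.
exists (ex_minn ex); case: ex_minnP => -[|k] yk kmin; rewrite yk /=.
  by rewrite expr0 mul1r.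
rewrite exprS -mulrA ler_pM2l// leNgt; apply/negP => /ltW/kmin.
by rewrite ltnn.
Qed.

Lemma dyadic_down x y : 0 < x -> x <= y ->
  exists k, y / 2 ^+ k.+1 < x <= y / 2 ^+ k.
Proof.
move=> x0 xy.
have ex : exists k, y / 2 ^+ k.+1 < x.
  have yk := upper_nthrootP (leqnn (Num.bound (y / x))); exists (Num.bound (y / x)).
  rewrite ltr_pdivrMr ?exprn_gt0// mulrC -ltr_pdivrMr//.
  by apply: (lt_le_trans yk); rewrite exprS ler_peMl// ?exprn_ge0// ler1n.
exists (ex_minn ex); case: ex_minnP => -[|k] yk kmin; rewrite yk /=.
  by rewrite expr0 divr1.
by rewrite leNgt; apply/negP => /kmin; rewrite ltnn.
Qed.

End Powers.

(** * Boxes in the tube domain and their volumes *)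

Section Boxes.
Context {R : realType} (m : nat).
Local Notation RT := (@RT R).
Local Notation Cn := (@Cn R).

Definition vol_measure n : {sigma_finite_measure set (Cn n) -> \bar R} :=
  prod_measure (leb_tuple n) (leb_tuple n).
Definition vol2_measure n :
    {sigma_finite_measure set (Cn n * Cn n)%type -> \bar R} :=
  prod_measure (vol_measure n) (vol_measure n).

Lemma volE n : vol n = vol_measure n.
Proof. by rewrite /vol leb_tupleE. Qed.

Lemma vol2E n : vol2 n = vol2_measure n.
Proof. by rewrite /vol2 volE. Qed.

Definition sqnorm (s : seq R) : R := \sum_(j < m) nth 0 s j ^+ 2.

(** The imaginary parts are sheared by [sqnorm], so the constraint on their last coordinate is
    exactly [t < rho u <= 2 * t]. The shear [phi] of the real parts is left free. *)
Definition tube_box (p : seq R * seq R) (h : R) (phi : seq R -> R) (L t : R) :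
    set (Cn m.+1) :=
  sheared_box p.1 h phi (- L) L `*` sheared_box p.2 h sqnorm t (2 * t).

Lemma measurable_sum_take (F : nat -> R -> R) :
  (forall j, measurable_fun setT (F j)) ->
  measurable_fun setT (fun s : m.+1.-tuple RT =>
    \sum_(j < m) F j (nth 0 (take m (s : seq R)) j)).
Proof.
move=> mF; apply: measurable_sum => j.
rewrite (_ : (fun s => _) = F j \o (fun s : m.+1.-tuple RT => nth 0 (s : seq R) j)).
  by apply: measurableT_comp => //; exact: nth_measurable.
by apply/funext => s /=; rewrite nth_take.
Qed.

Lemma measurable_tube_box p (h : R) phi (L t : R) :
  measurable_fun setT (fun s : m.+1.-tuple RT => phi (take m (s : seq R))) ->
  measurable (tube_box p h phi L t).
Proof.
move=> mphi; apply: measurableX; apply: measurable_sheared_box => //.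
apply: (measurable_sum_take (F := fun _ x => x ^+ 2)) => j.
exact: exprn_measurable.
Qed.

Lemma vol_tube_box p (h : R) phi (L t : R) :
  measurable_fun setT (fun s : m.+1.-tuple RT => phi (take m (s : seq R))) ->
  0 <= h -> 0 <= L -> 0 <= t ->
  vol_measure m.+1 (tube_box p h phi L t) =
  ((4 * h ^+ 2) ^+ m * (2 * L) * t)%:E.
Proof.
move=> mphi h0 L0 t0.
have msq : measurable_fun setT
    (fun s : m.+1.-tuple RT => sqnorm (take m (s : seq R))).
  apply: (measurable_sum_take (F := fun _ x => x ^+ 2)) => j.
  exact: exprn_measurable.
rewrite [LHS]product_measure1E; last 2 first.
- exact: measurable_sheared_box.
- exact: measurable_sheared_box.
have tt : t <= 2 * t by lra.
have LL : - L <= L by lra.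
have lebE A : leb_tuple m.+1 A = lebn m.+1 A by rewrite leb_tupleE.
transitivity (((2 * h) ^+ m * (L - - L))%:E * ((2 * h) ^+ m * (2 * t - t))%:E)%E.
  by congr (_ * _)%E; rewrite [LHS]lebE lebn_sheared_box.
rewrite -EFinM; congr EFin.
rewrite (_ : 4 * h ^+ 2 = (2 * h) * (2 * h)); last by ring.
by rewrite [in RHS]exprMn; set X := _ ^+ m; ring.
Qed.

Lemma rho_sqnorm (u : Cn m.+1) :
  rho u = nth 0 (u.2 : seq R) m - sqnorm (take m (u.2 : seq R)).
Proof.
rewrite /rho /sqnorm /=; congr (_ - _).
by apply: eq_bigr => j _; rewrite nth_take.
Qed.

Lemma tube_box_rho p (h : R) phi (L t : R) u :
  tube_box p h phi L t u -> t < rho u <= 2 * t.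
Proof. by rewrite rho_sqnorm => -[_ []]. Qed.

End Boxes.

Section ForelliRudin.
Context {R : realType} (m : nat).
Local Notation RT := (@RT R).
Local Notation Cn := (@Cn R m.+1).
Implicit Types z u : Cn.
Local Notation xc z j := (nth 0 (z.1 : seq R) j).
Local Notation yc z j := (nth 0 (z.2 : seq R) j).

(** With [u = s + i v], [s_n - box_shift z s] equals [2 Im (rho2 z u)] plus the sum of the
    [(x_j - s_j) (y_j - v_j)]. Replacing [y_j + v_j] by [2 y_j] makes the shift depend on real parts
    of [u] alone, as a shear requires. *)
Definition box_shift z (s : seq R) : R :=
  xc z m - \sum_(j < m) 2 * (xc z j - nth 0 s j) * yc z j.

Lemma measurable_box_shift z : measurable_fun setT
  (fun s : m.+1.-tuple RT => box_shift z (take m (s : seq R))).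
Proof.
apply: measurable_funB; first exact: measurable_cst.
apply: (measurable_sum_take (F := fun j x => 2 * (xc z j - x) * yc z j)) => j.
apply: measurable_funM => //; apply: measurable_funM => //.
exact: measurable_funB.
Qed.

(* Both coordinates of [u - z] are controlled by [Re (rho2 z u)], and the last
   one by [Im (rho2 z u)] up to the shear [box_shift z]. *)
Lemma tube_box_of_cabs z u (T t : R) : 0 < T -> TB m.+1 z -> TB m.+1 u ->
  cabs (rho2 z u) <= T -> t < rho u <= 2 * t ->
  tube_box (z.1 : seq R, z.2 : seq R) (2 * Num.sqrt T) (box_shift z)
    ((4 * m%:R + 3) * T) t u.
Proof.
move=> T0 Tz Tu rT tu.
have ReT : complex.Re (rho2 z u) <= T.
  by apply: (le_trans _ rT); apply: le_trans (ler_norm_Re_cabs _); exact: ler_norm.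
have ImT := le_trans (ler_norm_Im_cabs _) rT.
rewrite rho2_Re in ReT; rewrite rho2_Im in ImT.
have sq (F : 'I_m -> R) (j : 'I_m) : F j ^+ 2 <= \sum_(i < m) F i ^+ 2.
  by rewrite (bigD1 j)//= lerDl sumr_ge0// => i _; exact: sqr_ge0.
have sq0 (F : 'I_m -> R) : 0 <= \sum_(i < m) F i ^+ 2.
  by apply: sumr_ge0 => i _; exact: sqr_ge0.
have xs0 := sq0 (fun j => xc z j - xc u j); have ys0 := sq0 (fun j => yc z j - yc u j).
have rz : 0 < rho z by []. have ru : 0 < rho u by [].
have sT : Num.sqrt T ^+ 2 = T by rewrite sqr_sqrtr// ltW.
have h0 : 0 <= 2 * Num.sqrt T by rewrite mulr_ge0// sqrtr_ge0.
(* The real part is at most [T] and carries a factor 1/4, so every squared increment is at most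
   [4 * T]. *)
have small x : x ^+ 2 <= 4 * T -> `|x| <= 2 * Num.sqrt T.
  move=> xT; rewrite -(ler_pXn2r (n := 2)) ?nnegrE//.
  by rewrite real_normK ?num_real// exprMn sT; lra.
have hx (j : 'I_m) : `|xc z j - xc u j| <= 2 * Num.sqrt T.
  by apply: small; have := sq (fun j => xc z j - xc u j) j; move=> /=; lra.
have hy (j : 'I_m) : `|yc z j - yc u j| <= 2 * Num.sqrt T.
  by apply: small; have := sq (fun j => yc z j - yc u j) j; move=> /=; lra.
split; split => /=.
- by move=> j jm; rewrite distrC; exact: (hx (Ordinal jm)).
- have -> : box_shift z (take m (u.1 : seq R)) =
      xc z m - \sum_(j < m) 2 * (xc z j - xc u j) * yc z j.
    by congr (_ - _); apply: eq_bigr => j _; rewrite nth_take.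
  have cross : `|\sum_(j < m) (xc z j - xc u j) * (yc z j - yc u j)| <= m%:R * (4 * T).
    apply: (le_trans (ler_norm_sum _ _ _)).
    rewrite (_ : m%:R * _ = \sum_(j < m) (4 * T)); last first.
      by rewrite sumr_const card_ord -[RHS]mulr_natl.
    apply: ler_sum => j _; rewrite normrM.
    apply: (le_trans (ler_pM _ _ (hx j) (hy j))) => //.
    by rewrite mulrACA -[Num.sqrt T * _]expr2 sT; lra.
  have split_sum : \sum_(j < m) (xc z j - xc u j) * (yc z j + yc u j) =
      \sum_(j < m) 2 * (xc z j - xc u j) * yc z j -
      \sum_(j < m) (xc z j - xc u j) * (yc z j - yc u j).
    by rewrite -sumrB; apply: eq_bigr => j _; ring.
  move: ImT cross; rewrite split_sum.
  set A := \sum_(j < m) 2 * _ * _; set B := \sum_(j < m) (_ * _).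
  (* The imaginary part contributes [2 * T] and the cross terms [4 * m * T]; one further [T]
     provides the strict inequality at the open end. *)
  rewrite !ler_norml => /andP[i1 i2] /andP[c1 c2].
  by apply/andP; split; lra.
- by move=> j jm; rewrite distrC; exact: (hy (Ordinal jm)).
- by rewrite -rho_sqnorm.
Qed.

Lemma measurable_rho : measurable_fun setT (fun z : Cn => rho z : RT).
Proof.
apply: measurable_funB.
  by apply: (measurableT_comp (@nth_measurable R m.+1 m)); exact: measurable_snd.
apply: measurable_sum => j; apply: measurable_funX.
by apply: (measurableT_comp (@nth_measurable R m.+1 j)); exact: measurable_snd.
Qed.

Lemma measurable_TB : measurable (TB m.+1 : set Cn).
Proof.
rewrite (_ : TB m.+1 = (fun z : Cn => rho z : RT) @^-1` `]0, +oo[).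
  by rewrite -[X in measurable X]setTI; exact: measurable_rho.
by apply/seteqP; split => z; rewrite /TB/= in_itv/= andbT.
Qed.

Lemma forelli_rudin (b c : R) : -1 < b -> m%:R + 2 + b < c ->
  exists2 C : R, 0 <= C & forall z, TB m.+1 z ->
  (\int[vol_measure m.+1]_(u in TB m.+1) (rho u `^ b / cabs (rho2 z u) `^ c)%:E
   <= (C * rho z `^ (m%:R + 2 + b - c))%:E)%E.
Proof.
move=> b1 cb; set e := m%:R + 2 + b - c.
have c0 : 0 < c by apply: le_lt_trans cb; have : 0 <= m%:R :> R by []; lra.
(* The decay rates over the levels [k] of [cabs (rho2 z u)] and [l] of [rho u]; they are below 1
   exactly because [e < 0] and [b + 1 > 0]. *)
pose p : R := 2 `^ e; pose q : R := 2^-1 `^ (b + 1).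
have p01 : 0 < p < 1.
  by rewrite powR_gt0// powR2_lt1 ?subr_lt0.
have q01 : 0 < q < 1.
  rewrite powR_gt0 ?invr_gt0//= /q -[X in X `^ _]powR_inv1// -powRrM.
  by apply: powR2_lt1; lra.
(* The first two factors are the losses in replacing [rho u] and [cabs (rho2 z u)] by dyadic values;
   the rest is the constant in the box volume. *)
pose K : R := 2 `^ `|b| * 2 `^ c * (16 ^+ m * (2 * (4 * m%:R + 3))).
have K0 : 0 <= K.
  by rewrite !mulr_ge0 ?powR_ge0 ?exprn_ge0// addr_ge0// mulr_ge0.
exists (K / (1 - q) / (1 - p)).
  by rewrite !divr_ge0// subr_ge0 ltW//; [case/andP: q01|case/andP: p01].
move=> z Tz; have r0 : 0 < rho z by [].
rewrite (_ : _ * _ = (K * rho z `^ e) / (1 - q) / (1 - p)); last by ring.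
pose T k : R := 2 ^+ k * rho z; pose t k l : R := T k / 2 ^+ l.
have T0 k : 0 < T k by rewrite mulr_gt0// exprn_gt0.
have t0 k l : 0 < t k l by rewrite divr_gt0// exprn_gt0.
apply: (integral_le_double_geometric (B := fun k l =>
    tube_box (z.1 : seq R, z.2 : seq R) (2 * Num.sqrt (T k)) (box_shift z)
      ((4 * m%:R + 3) * T k) (t k l))
  (M := fun k l => 2 `^ `|b| * t k l `^ b * (2 `^ c / T k `^ c))) => //.
- exact: measurable_TB.
- by move=> k l; apply: measurable_tube_box; exact: measurable_box_shift.
- by move=> k l; rewrite !mulr_ge0// ?invr_ge0 ?powR_ge0.
- by rewrite mulr_ge0// powR_ge0.
- by move=> u Tu; rewrite lee_fin divr_ge0// powR_ge0.
- move=> u Tu; have ru : 0 < rho u by [].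
  have zu := cabs_rho2_ge z u.
  (* Applicable since [rho z <= 2 * cabs (rho2 z u)]. *)
  have [k /andP[k1 k2]] : exists k, cabs (rho2 z u) <= 2 ^+ k * rho z <=
      2 * cabs (rho2 z u) by apply: dyadic_up => //; lra.
  (* Starting from [2 * T k], which bounds [rho u], yields the range [t k l < rho u <= 2 * t k l] of
     the box. *)
  have [l /andP[l1 l2]] : exists l, 2 * T k / 2 ^+ l.+1 < rho u <= 2 * T k / 2 ^+ l.
    by apply: dyadic_down => //; rewrite /T; lra.
  have tl : t k l < rho u <= 2 * t k l.
    rewrite /t mulrA l2 andbT; apply: le_lt_trans l1.
    by rewrite exprS invfM mulrACA mulfV// mul1r.
  exists k, l; split; first by apply: tube_box_of_cabs.
  rewrite lee_fin; apply: ler_pM; rewrite ?invr_ge0 ?powR_ge0//.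
    have /andP[t1 t2] := tl.
    suff /andP[] : 2 `^ (- `|b|) * t k l `^ b <= rho u `^ b <=
      2 `^ `|b| * t k l `^ b by [].
    by apply: powR_near; rewrite ?ler1n//; lra.
  have ca0 := cabs_rho2_gt0 Tz Tu.
  rewrite -invf_div lef_pV2 ?posrE ?divr_gt0 ?powR_gt0//.
  rewrite ler_pdivrMr ?powR_gt0// -powRM// ?cabs_ge0//.
  apply: ge0_ler_powR; rewrite ?nnegrE ?mulr_ge0 ?cabs_ge0//; last by rewrite mulrC.
    exact: ltW.
  exact: ltW.
- move=> k l; cbv beta; rewrite [X in (_ * X)%E]vol_tube_box; last 4 first.
  + exact: measurable_box_shift.
  + by rewrite mulr_ge0// sqrtr_ge0.
  + by rewrite mulr_ge0 ?ltW// ltr_wpDl// mulr_ge0.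
  + exact: ltW.
  rewrite -EFinM lee_fin le_eqVlt; apply/orP; left; apply/eqP.
  rewrite (_ : 4 * (2 * Num.sqrt (T k)) ^+ 2 = 16 * T k); last first.
    by rewrite exprMn sqr_sqrtr ?ltW//; ring.
  (* Integrand and height of the box together give the power [b + 1] of [t k l], which decays in
     [l]; all powers of [T k] then add up to [e]. *)
  have tb : t k l `^ b * t k l = T k `^ (b + 1) * q ^+ l.
    rewrite -[X in _ * X](powRr1 (ltW (t0 k l))) -powRD_gt0//.
    rewrite /t powRM ?invr_ge0 ?exprn_ge0 ?(ltW (T0 k))//.
    by rewrite -exprVn powR_exprn ?invr_ge0.
  have Te : T k `^ (b + 1) * T k ^+ m * T k / T k `^ c = rho z `^ e * p ^+ k.
    rewrite -[X in _ * X / _](powRr1 (ltW (T0 k))) -powR_mulrn ?ltW//.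
    rewrite -powRN -!powRD_gt0//.
    rewrite (_ : _ + _ - c = e); last by rewrite /e; ring.
    by rewrite /T powRM ?exprn_ge0// ?ltW// powR_exprn// mulrC.
  rewrite [(16 * T k) ^+ m]exprMn /K.
  transitivity (2 `^ `|b| * 2 `^ c * (16 ^+ m * (2 * (4 * m%:R + 3))) *
    (t k l `^ b * t k l) * (T k ^+ m * T k / T k `^ c)).
    by ring.
  rewrite tb.
  transitivity (2 `^ `|b| * 2 `^ c * (16 ^+ m * (2 * (4 * m%:R + 3))) * q ^+ l *
    (T k `^ (b + 1) * T k ^+ m * T k / T k `^ c)).
    by ring.
  by rewrite Te; ring.
Qed.

End ForelliRudin.

(** * Essential suprema and measurability *)

Lemma measurable_fun_powR {R : realType} d (T : measurableType d) (D : set T)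
    (g : T -> R) p :
  measurable_fun D g -> measurable_fun D (fun x => g x `^ p).
Proof. by move=> mg; exact: (measurableT_comp (measurable_powR p) mg). Qed.

Section EssSup.
Local Open Scope ereal_scope.
Context {R : realType} (m : nat).
Local Notation RT := (@RT R).
Local Notation Cn := (@Cn R m.+1).
Local Notation TB := (@TB R m.+1).
Local Notation mu := (@vol_measure R m.+1).

(** The weight [rho z ^ alpha] is positive on [TB], so weighted null sets are Lebesgue null
    there. *)
Lemma volw_null (alpha : R) (A : set Cn) : measurable A ->
  volw m.+1 alpha A = 0 -> mu (A `&` TB) = 0.
Proof.
move=> mA; rewrite /volw volE => w0.
have mAT : measurable (A `&` TB) by apply: measurableI => //; exact: measurable_TB.
have mr : measurable_fun (A `&` TB) (fun z : Cn => (rho z `^ alpha)%:E).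
  apply/measurable_EFinP; apply: measurable_funTS.
  by apply: measurable_fun_powR; exact: measurable_rho.
apply: measure_negligible => //.
have : \int[mu]_(z in A `&` TB) `|(rho z `^ alpha)%:E| = 0.
  by rewrite -w0; apply: eq_integral => z _; rewrite gee0_abs// lee_fin powR_ge0.
move=> /(ae_eq_integral_abs _ mAT mr); apply: negligibleS => z Az /= /(_ Az).
by case=> /eqP; rewrite gt_eqF// powR_gt0//; case: Az.
Qed.

Lemma vol_TB_gt0 : 0 < mu TB.
Proof.
have mb : measurable_fun setT (fun s : m.+1.-tuple RT => cst 0%R (take m (s : seq R)) : R).
  exact: measurable_cst.
have sub : tube_box ([::], [::]) 1 (cst 0%R) 1 1 `<=` TB.
  by move=> u /tube_box_rho /andP[u1 _]; rewrite /Defs.TB/=; exact: lt_trans u1.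
apply: (@lt_le_trans _ _ (mu (tube_box ([::], [::]) 1 (cst 0%R) 1 1))).
  rewrite vol_tube_box// lte_fin !mulr_gt0// exprn_gt0// mulr_gt0// expr1n.
apply: le_measure; rewrite ?inE//; last exact: measurable_TB.
exact: measurable_tube_box.
Qed.

(** A negative essential bound would be exceeded on all of [TB], making [TB] null. *)
Lemma ess_sup_on_ge0 (alpha : R) (g : Cn -> R) : (forall z, 0 <= g z)%R ->
  0 <= ess_sup_on (volw m.+1 alpha) TB g.
Proof.
move=> g0; apply: le_ereal_inf_tmp => y /= [A [mA A0 sA]].
rewrite leNgt; apply/negP => y0.
have TA : TB `<=` A.
  by move=> z Tz; apply: sA; split => //; apply: (lt_le_trans y0); rewrite lee_fin.
have := vol_TB_gt0; rewrite -(setIidr TA) (volw_null mA A0).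
by rewrite ltxx.
Qed.

(** An infimum is only approached: the exceptional set is the countable union of the null sets for
    the levels [e + 1 / (k + 1)]. *)
Lemma ess_sup_on_ae (alpha : R) (g : Cn -> R) (e : R) :
  ess_sup_on (volw m.+1 alpha) TB g = e%:E ->
  mu.-negligible [set z | TB z /\ (e < g z)%R].
Proof.
move=> ge.
have neg k : mu.-negligible [set z | TB z /\ (e + k.+1%:R^-1 < g z)%R].
  have : ess_sup_on (volw m.+1 alpha) TB g < (e + k.+1%:R^-1)%:E.
    by rewrite ge lte_fin ltrDl.
  move=> /ereal_inf_lt [y [A [mA A0 sA]] ye].
  exists (A `&` TB); split.
  - by apply: measurableI => //; exact: measurable_TB.
  - exact: (volw_null mA A0).
  - move=> z [Tz ez]; split => //; apply: sA; split => //.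
    by apply: (lt_trans ye); rewrite lte_fin.
have := negligible_bigcup neg; apply: negligibleS => z [Tz ez].
have [k kz] : exists k, (k.+1%:R^-1 < g z - e)%R.
  have ge0 : (0 <= (g z - e)^-1)%R by rewrite invr_ge0 subr_ge0 ltW.
  exists (Num.bound (g z - e)^-1); rewrite invf_plt ?posrE ?subr_gt0//.
  by apply: (lt_le_trans (archi_boundP ge0)); rewrite ler_nat.
by exists k => //; split => //; rewrite -ltrBrDl.
Qed.

End EssSup.

(** * Measurability of the kernels *)

Section KernelMeasurability.
Context {R : realType} (m : nat).
Local Notation RT := (@RT R).
Local Notation Cn := (@Cn R m.+1).

Lemma measurable_rho2_Re (z : Cn) :
  measurable_fun setT (fun u : Cn => complex.Re (rho2 z u) : RT).
Proof.
have mx j : measurable_fun setT (fun u : Cn => nth 0 (u.1 : seq R) j : RT).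
  by apply: (measurableT_comp (@nth_measurable R m.+1 j)); exact: measurable_fst.
have my j : measurable_fun setT (fun u : Cn => nth 0 (u.2 : seq R) j : RT).
  by apply: (measurableT_comp (@nth_measurable R m.+1 j)); exact: measurable_snd.
under eq_fun do rewrite rho2_Re.
apply: measurable_funM => //; apply: measurable_funD.
  apply: measurable_funD; apply: measurable_sum => j; apply: measurable_funX.
    by apply: measurable_funB => //; exact: mx.
  by apply: measurable_funB => //; exact: my.
by apply: measurable_funM => //; apply: measurable_funD => //; exact: measurable_rho.
Qed.

Lemma measurable_rho2_Im (z : Cn) :
  measurable_fun setT (fun u : Cn => complex.Im (rho2 z u) : RT).
Proof.
have mx j : measurable_fun setT (fun u : Cn => nth 0 (u.1 : seq R) j : RT).
  by apply: (measurableT_comp (@nth_measurable R m.+1 j)); exact: measurable_fst.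
have my j : measurable_fun setT (fun u : Cn => nth 0 (u.2 : seq R) j : RT).
  by apply: (measurableT_comp (@nth_measurable R m.+1 j)); exact: measurable_snd.
under eq_fun do rewrite rho2_Im.
apply: measurable_funM => //; apply: measurable_funB; last by apply: measurable_funB => //; exact: mx.
by apply: measurable_sum => j; apply: measurable_funM;
  [apply: measurable_funB => //; exact: mx|apply: measurable_funD => //; exact: my].
Qed.

Lemma measurable_cabs d (T : measurableType d) (D : set T) (g : T -> R[i]) :
  measurable_fun D (fun x => complex.Re (g x) : RT) ->
  measurable_fun D (fun x => complex.Im (g x) : RT) ->
  measurable_fun D (fun x => cabs (g x) : RT).
Proof.
move=> mr mi; apply: (@measurableT_comp _ _ _ _ _ _ (@Num.sqrt R)).
  by apply: continuous_measurable_fun; exact: sqrt_continuous.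
by apply: measurable_funD; exact: measurable_funX.
Qed.

Lemma measurable_skernel (a b c : R * R) (z w : Cn) :
  measurable_fun setT (fun ue : Cn * Cn => skernel a b c z w ue.1 ue.2 : RT).
Proof.
have mc (v : Cn) : measurable_fun setT (fun u : Cn => cabs (rho2 v u) : RT).
  by apply: measurable_cabs; [exact: measurable_rho2_Re|exact: measurable_rho2_Im].
under eq_fun do rewrite /skernel invfM -!powRN.
apply: measurable_funM; apply: measurable_funM.
- apply: measurable_funM => //; apply: measurable_fun_powR.
  by apply: (measurableT_comp (@measurable_rho R m)); exact: measurable_fst.
- apply: measurable_fun_powR.
  by apply: (measurableT_comp (@measurable_rho R m)); exact: measurable_snd.
- by apply: measurable_fun_powR; apply: (measurableT_comp (mc z)); exact: measurable_fst.
- by apply: measurable_fun_powR; apply: (measurableT_comp (mc w)); exact: measurable_snd.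
Qed.

(* [Re ^-1] is written as a power: [powR] is known to be measurable. *)
Definition mkangle (c : R * R) (z w : Cn) (ue : Cn * Cn) : R :=
  c.1 * atan (complex.Im (rho2 z ue.1) * complex.Re (rho2 z ue.1) `^ (- 1)) +
  c.2 * atan (complex.Im (rho2 w ue.2) * complex.Re (rho2 w ue.2) `^ (- 1)).

Lemma mkangleE c z w ue : TB m.+1 z -> TB m.+1 w ->
  (TB m.+1 `*` TB m.+1) ue -> mkangle c z w ue = kangle c z w ue.1 ue.2.
Proof.
move=> Tz Tw [Tu Te]; rewrite /mkangle /kangle !powR_inv1// ltW//.
  exact: rho2_Re_gt0.
exact: rho2_Re_gt0.
Qed.

Lemma measurable_mkangle c z w : measurable_fun setT (mkangle c z w : _ -> RT).
Proof.
have matan : measurable_fun setT (@atan R).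
  by apply: continuous_measurable_fun => x; exact: continuous_atan.
have mq (v : Cn) : measurable_fun setT (fun u : Cn =>
    complex.Im (rho2 v u) * complex.Re (rho2 v u) `^ (- 1) : RT).
  apply: measurable_funM; first exact: measurable_rho2_Im.
  by apply: measurable_fun_powR; exact: measurable_rho2_Re.
apply: measurable_funD; apply: measurable_funM => //; apply: (measurableT_comp matan).
  by apply: (measurableT_comp (mq z)); exact: measurable_fst.
by apply: (measurableT_comp (mq w)); exact: measurable_snd.
Qed.

End KernelMeasurability.

(** * Sufficiency *)

Section Sufficiency.
Context {R : realType} (m : nat).
Local Notation RT := (@RT R).
Local Notation Cn := (@Cn R m.+1).
Local Notation TB := (@TB R m.+1).
Local Notation mu := (@vol_measure R m.+1).
Local Notation mu2 := (@vol2_measure R m.+1).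
Variables (a b c alpha : R * R).
Hypotheses (a1 : 0 < a.1) (a2 : 0 <= a.2) (b1 : -1 < b.1) (b2 : alpha.2 <= b.2).
Hypotheses (c1 : c.1 = m.+1%:R + 1 + a.1 + b.1) (c2 : c.2 = a.2 + b.2 - alpha.2).

(** Once [rho eta ^ alpha.2] is split off, the exponents [a.2] and [b.2 - alpha.2] are nonnegative
    with sum [c.2], and both [rho w] and [rho eta] are at most [2 * cabs (rho2 w eta)]. *)
Lemma kernel2_bound (w eta : Cn) : TB w -> TB eta ->
  rho w `^ a.2 * rho eta `^ b.2 / cabs (rho2 w eta) `^ c.2 <=
  2 `^ c.2 * rho eta `^ alpha.2.
Proof.
move=> Tw Te; have rw : 0 < rho w by []. have re : 0 < rho eta by [].
have D0 := cabs_rho2_gt0 Tw Te; have Dge := cabs_rho2_ge w eta.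
rewrite ler_pdivrMr ?powR_gt0//.
have mono (x p : R) : 0 <= p -> 0 < x -> x <= 2 * cabs (rho2 w eta) ->
    x `^ p <= (2 * cabs (rho2 w eta)) `^ p.
  by move=> p0 x0 xD; apply: ge0_ler_powR => //; rewrite nnegrE ?mulr_ge0// ltW.
have -> : rho eta `^ b.2 = rho eta `^ (b.2 - alpha.2) * rho eta `^ alpha.2.
  by rewrite -powRD_gt0// subrK.
rewrite mulrA [leRHS]mulrAC ler_wpM2r ?powR_ge0// -powRM ?(ltW D0)//.
rewrite c2 -addrA [leRHS]powRD_gt0 ?mulr_gt0//.
apply: ler_pM; rewrite ?powR_ge0//; apply: mono; rewrite ?subr_ge0//; lra.
Qed.

(** The size estimate shared by both operators, at every point of the tube: Tonelli puts the
    [u]-integral inside, where [f] is replaced by its essential supremum and the Forelli-Rudin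
    estimate applies. *)
Lemma schur_bound : exists2 C : R, 0 < C &
  forall (f : Cn * Cn -> R[i]) (z w : Cn),
  measurable_fun (TB `*` TB) (fun p => complex.Re (f p) : RT) ->
  measurable_fun (TB `*` TB) (fun p => complex.Im (f p) : RT) ->
  TB z -> TB w ->
  (\int[mu2]_(p in TB `*` TB) (skernel a b c z w p.1 p.2 * cabs (f p))%:E
   <= C%:E * mixnorm_inf1 m.+1 alpha f)%E.
Proof.
have cb : m%:R + 2 + b.1 < c.1 by move: a1; rewrite c1 -natr1; lra.
have [C1 C10 FR] := forelli_rudin b1 cb.
(* Adding 1 makes the constant positive, so that it can be inverted below. *)
pose C := C1 * 2 `^ c.2 + 1.
have C0 : 0 < C by rewrite ltr_wpDl// mulr_ge0// powR_ge0.
exists C => // f z w mRe mIm Tz Tw.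
have rz : 0 < rho z by [].
have mT : measurable (TB `*` TB) by apply: measurableX; exact: measurable_TB.
pose F : Cn * Cn -> \bar R :=
  (fun p => (skernel a b c z w p.1 p.2 * cabs (f p))%:E) \_ (TB `*` TB).
have F0 p : (0 <= F p)%E.
  rewrite /F patchE; case: ifPn => // _.
  by rewrite lee_fin mulr_ge0 ?skernel_ge0 ?cabs_ge0.
have mF : measurable_fun setT F.
  apply: (proj1 (measurable_restrictT _ mT)); apply/measurable_EFinP.
  apply: measurable_funM; last exact: measurable_cabs.
  by apply: measurable_funTS; exact: measurable_skernel.
have mG := @measurable_fun_fubini_tonelli_G _ _ _ _ _ mu F mF F0.
rewrite integral_mkcond -/F.
rewrite [leLHS](@fubini_tonelli2 _ _ _ _ _ mu mu F mF F0).
pose E eta := ess_sup_on (volw m.+1 alpha.1) TB (fun u => cabs (f (u, eta))).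
have E0 eta : (0 <= E eta)%E by apply: ess_sup_on_ge0 => u; exact: cabs_ge0.
have key eta : (fubini_G mu F eta <=
    C%:E * ((fun x => E x * (rho x `^ alpha.2)%:E) \_ TB eta))%E.
  rewrite /fubini_G patchE; case: ifPn => [/set_mem Te|/negP Te]; last first.
    rewrite mule0 integral0_eq// => u _; rewrite /F patchE.
    by case: ifPn => // /set_mem [_ /= Te']; exfalso; apply: Te; rewrite inE.
  have re : 0 < rho eta `^ alpha.2 by exact: powR_gt0.
  (* An infinite essential supremum makes the right-hand side infinite, as [C] and the weight are
     positive. *)
  case Ee: (E eta) => [e| |]; last 2 first.
  - by rewrite gt0_mulye ?lte_fin// gt0_muley ?lte_fin// leey.
  - by have := E0 eta; rewrite Ee.
  have e0 : 0 <= e by have := E0 eta; rewrite Ee lee_fin.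
  pose kap := rho z `^ a.1 * (rho w `^ a.2 * rho eta `^ b.2 /
    cabs (rho2 w eta) `^ c.2) * e.
  have kap0 : 0 <= kap by rewrite !mulr_ge0// ?invr_ge0 ?powR_ge0.
  pose h u : R := rho u `^ b.1 / cabs (rho2 z u) `^ c.1.
  have mh : measurable_fun setT (h : Cn -> RT).
    rewrite /h; under eq_fun do rewrite -powRN.
    apply: measurable_funM; apply: measurable_fun_powR; first exact: measurable_rho.
    by apply: measurable_cabs; [exact: measurable_rho2_Re|exact: measurable_rho2_Im].
  have h0 u : 0 <= h u by rewrite divr_ge0// powR_ge0.
  apply: (@le_trans _ _ (\int[mu]_(u in TB) (kap%:E * (h u)%:E))%E).
    rewrite [leRHS]integral_mkcond; apply: ae_ge0_le_integral => //.
    - exact: (measurable_fun_pair1 eta mF).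
    - move=> u _; rewrite patchE; case: ifPn => // _.
      by rewrite -EFinM lee_fin mulr_ge0.
    - apply: (proj1 (measurable_restrictT _ (@measurable_TB R m))).
      apply: measurable_funTS; apply/measurable_EFinP.
      by apply: measurable_funM.
    (* The comparison can fail only where [cabs (f (u, eta))] exceeds [e], a null set of [u]. *)
    have := ess_sup_on_ae Ee; apply: negligibleS => u /=.
    move=> /not_implyP[_ /negP]; rewrite -ltNge /F !patchE.
    have [Tu|nTu] := pselect (TB u); last first.
      by rewrite memNset// memNset ?ltxx// => -[].
    rewrite mem_set// mem_set//= -EFinM lte_fin => lt1; split => //.
    rewrite ltNge; apply/negP => fe; move: lt1; rewrite ltNge => /negP; apply.
    rewrite (_ : kap * h u = skernel a b c z w u eta * e); last first.
      by rewrite /kap /h /skernel invfM; ring.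
    by rewrite ler_wpM2l// skernel_ge0.
  have mhT : measurable_fun TB (fun u => (h u)%:E).
    by apply: measurable_funTS; apply/measurable_EFinP.
  rewrite (ge0_integralZl mu (@measurable_TB R m) mhT) ?lee_fin//; last first.
    by move=> u _; rewrite lee_fin.
  apply: (le_trans (lee_wpmul2l _ (FR z Tz))); first by rewrite lee_fin.
  rewrite -!EFinM lee_fin.
  (* The Forelli-Rudin exponent is [- a.1], which cancels [rho z ^ a.1]. *)
  have -> : m%:R + 2 + b.1 - c.1 = - a.1 by rewrite c1 -natr1; ring.
  rewrite powRN.
  have kb := kernel2_bound Tw Te.
  have -> : kap * (C1 * (rho z `^ a.1)^-1) = e * C1 *
      (rho w `^ a.2 * rho eta `^ b.2 / cabs (rho2 w eta) `^ c.2).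
    rewrite /kap; field.
    by rewrite !gt_eqF// powR_gt0//; exact: cabs_rho2_gt0.
  apply: (le_trans (ler_wpM2l _ kb)); first by rewrite mulr_ge0.
  rewrite /C; have : 0 <= e * rho eta `^ alpha.2 by rewrite mulr_ge0// ltW.
  by lra.
(* The essential supremum has not been shown measurable in [eta], so the constant is taken out of
   the integral of the measurable [fubini_G], and the remaining comparison uses monotonicity
   only. *)
have Ci : (C%:E * (C^-1)%:E = 1)%E by rewrite -EFinM mulfV// gt_eqF.
have GC : (C%:E * \int[mu]_y ((C^-1)%:E * fubini_G mu F y) =
    \int[mu]_y fubini_G mu F y)%E.
  rewrite ge0_integralZl//; last 2 first.
  - by move=> y _; apply: integral_ge0.
  - by rewrite lee_fin invr_ge0 ltW.
  by rewrite muleA Ci mul1e.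
rewrite [leLHS](esym GC) /mixnorm_inf1 volE; apply: lee_wpmul2l; first by rewrite lee_fin ltW.
rewrite [leRHS]integral_mkcond; apply: ge0_le_lower_integral => eta _.
  by rewrite mule_ge0 ?lee_fin ?invr_ge0 ?(ltW C0)//; apply: integral_ge0.
apply: (le_trans (lee_wpmul2l _ (key eta))); first by rewrite lee_fin invr_ge0 ltW.
by rewrite muleA muleC -EFinM mulVf ?gt_eqF// mule1.
Qed.

End Sufficiency.

Lemma integrable_dominated {R : realType} d (T : measurableType d)
    (mu : {measure set T -> \bar R}) (D : set T) (g s : T -> R) (M : \bar R) :
  measurable D -> measurable_fun D g -> (forall x, D x -> `|g x| <= s x) ->
  (\int[mu]_(x in D) (s x)%:E <= M)%E -> (M < +oo)%E ->
  mu.-integrable D (EFin \o g) /\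
  (`|fine (\int[mu]_(x in D) (g x)%:E)|%:E <= M)%E.
Proof.
move=> mD mg gs sM Moo.
have gM : (\int[mu]_(x in D) `|(g x)%:E| <= M)%E.
  apply: le_trans sM; apply: ge0_le_lower_integral => x Dx; first exact: abse_ge0.
  by rewrite /= lee_fin; exact: gs.
have mgE : measurable_fun D (EFin \o g) by exact/measurable_EFinP.
have ig : mu.-integrable D (EFin \o g).
  by apply/integrableP; split => //; exact: le_lt_trans gM Moo.
split => //; rewrite -abse_EFin fineK; last exact: integrable_fin_num ig.
exact: le_trans (le_abse_integral mu mD mgE) gM.
Qed.

(** * Boundedness of both operators from the size estimate *)

Section SufficiencyBounded.
Context {R : realType} (m : nat).
Local Notation RT := (@RT R).
Local Notation Cn := (@Cn R m.+1).
Local Notation TB := (@TB R m.+1).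
Local Notation mu2 := (@vol2_measure R m.+1).
Variables (a b c alpha : R * R).

(** What the two kernels have in common: [skernel] times a complex factor with bounded measurable
    parts, [1] for [Skernel] and a unimodular phase for [Tkernel]. *)
Definition phase_kernel (K : Cn -> Cn -> Cn -> Cn -> R[i]) :=
  forall z w, TB z -> TB w -> exists A B : Cn * Cn -> R,
  [/\ measurable_fun setT (A : _ -> RT), measurable_fun setT (B : _ -> RT),
      forall p, `|A p| <= 1 /\ `|B p| <= 1 &
      forall p, (TB `*` TB) p -> K z w p.1 p.2 =
        Complex (skernel a b c z w p.1 p.2 * A p)
                (skernel a b c z w p.1 p.2 * B p)].

Lemma phase_Skernel : phase_kernel (Skernel a b c).
Proof.
move=> z w Tz Tw; exists (cst 1), (cst 0); split=> //.
  by move=> p; rewrite /= normr1 normr0.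
by move=> p _; rewrite SkernelE mulr1 mulr0.
Qed.

Lemma phase_Tkernel : phase_kernel (Tkernel a b c).
Proof.
move=> z w Tz Tw.
exists (fun p => cos (mkangle c z w p)), (fun p => - sin (mkangle c z w p)); split.
- apply: (measurableT_comp _ (measurable_mkangle c z w)).
  by apply: continuous_measurable_fun; exact: continuous_cos.
- apply: measurable_funN; apply: (measurableT_comp _ (measurable_mkangle c z w)).
  by apply: continuous_measurable_fun; exact: continuous_sin.
- move=> p; rewrite normrN; split; rewrite ler_norml.
    by rewrite cos_geN1 cos_le1.
  by rewrite sin_geN1 sin_le1.
- by move=> p pT; have [Tu Te] := pT; rewrite TkernelE// mkangleE// mulrN.
Qed.

Lemma bounded_of_phase_kernel (K : Cn -> Cn -> Cn -> Cn -> R[i]) :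
  0 < a.1 -> 0 <= a.2 -> -1 < b.1 -> alpha.2 <= b.2 ->
  c.1 = m.+1%:R + 1 + a.1 + b.1 -> c.2 = a.2 + b.2 - alpha.2 ->
  phase_kernel K -> bounded_inf1_to_inf m.+1 alpha K.
Proof.
move=> a1 a2 b1 b2 c1 c2 phK.
have [C C0 SB] := schur_bound a1 a2 b1 b2 c1 c2.
(* A factor 2 for the two products in each part of [K * f], and another for adding the real and
   imaginary parts. *)
exists (4 * C) => f mRe mIm; set N := mixnorm_inf1 _ _ _ => Noo.
have N0 : (0 <= N)%E.
  rewrite /N /mixnorm_inf1 volE; apply: integral_ge0 => w _.
  by rewrite mule_ge0 ?lee_fin ?powR_ge0//; apply: ess_sup_on_ge0 => u; exact: cabs_ge0.
have [r NE] : exists r, N = r%:E.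
  by exists (fine N); rewrite fineK// ge0_fin_numE.
have mT : measurable (TB `*` TB) by apply: measurableX; exact: measurable_TB.
rewrite vol2E.
(* The estimate holds at every point, so both exceptional sets are empty. *)
suff main zw : (TB `*` TB) zw ->
    cintegrable mu2 (TB `*` TB) (fun ue => K zw.1 zw.2 ue.1 ue.2 * f ue) /\
    ((cabs (kop K f zw))%:E <= (4 * C)%:E * N)%E.
  split.
    apply: negligibleS (negligible_set0 mu2) => zw [Tzw]; apply.
    by have [] := main zw Tzw.
  apply: ereal_inf_lbound => /=.
  apply: negligibleS (negligible_set0 mu2) => zw [Tzw] /=.
  by rewrite ltNge => /negP; apply; have [] := main zw Tzw.
case: zw => z w [/= Tz Tw].
have [A [B [mA mB AB1 KE]]] := phK z w Tz Tw.
pose s p := skernel a b c z w p.1 p.2 * cabs (f p).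
have s0 p : 0 <= s p by rewrite mulr_ge0 ?skernel_ge0 ?cabs_ge0.
have ms : measurable_fun (TB `*` TB) (s : _ -> RT).
  apply: measurable_funM; last exact: measurable_cabs.
  by apply: measurable_funTS; exact: measurable_skernel.
have s2 : (\int[mu2]_(p in TB `*` TB) (2 * s p)%:E <= (2 * C)%:E * N)%E.
  under eq_integral do rewrite EFinM.
  rewrite ge0_integralZl//; last 2 first.
  - exact/measurable_EFinP.
  - by move=> p _; rewrite lee_fin.
  by rewrite EFinM -muleA lee_wpmul2l//; exact: SB.
have CN : ((2 * C)%:E * N < +oo)%E by rewrite NE -EFinM ltry.
have bound (x y : R) p : (TB `*` TB) p -> `|x| <= 1 -> `|y| <= 1 ->
    `|skernel a b c z w p.1 p.2 * x * complex.Re (f p) +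
      skernel a b c z w p.1 p.2 * y * complex.Im (f p)| <= 2 * s p.
  move=> _ x1 y1; apply: (le_trans (ler_normD _ _)); rewrite /s.
  move: (skernel_ge0 a b c z w p.1 p.2); move: (skernel _ _ _ _ _ _ _) => k k0.
  rewrite !normrM (ger0_norm k0) (_ : 2 * _ = k * cabs (f p) + k * cabs (f p));
    last by ring.
  have le1 (v t q : R) : v <= 1 -> 0 <= v -> 0 <= t -> t <= q -> v * t <= q.
    by move=> v1 v0 t0 tk; apply: le_trans tk; rewrite ler_piMl.
  apply: lerD; rewrite -mulrA ler_wpM2l//; apply: le1 => //.
    exact: ler_norm_Re_cabs.
  exact: ler_norm_Im_cabs.
have ReE p : (TB `*` TB) p -> complex.Re (K z w p.1 p.2 * f p) =
    skernel a b c z w p.1 p.2 * A p * complex.Re (f p) +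
    skernel a b c z w p.1 p.2 * (- B p) * complex.Im (f p).
  by move=> pT; rewrite Re_mul KE//=; ring.
have ImE p : (TB `*` TB) p -> complex.Im (K z w p.1 p.2 * f p) =
    skernel a b c z w p.1 p.2 * B p * complex.Re (f p) +
    skernel a b c z w p.1 p.2 * A p * complex.Im (f p).
  by move=> pT; rewrite Im_mul KE//=; ring.
have msk : measurable_fun (TB `*` TB)
    (fun p => skernel a b c z w p.1 p.2 : RT).
  by apply: measurable_funTS; exact: measurable_skernel.
have mlin (X Y : Cn * Cn -> R) : measurable_fun setT (X : _ -> RT) ->
    measurable_fun setT (Y : _ -> RT) ->
    measurable_fun (TB `*` TB) (fun p =>
      skernel a b c z w p.1 p.2 * X p * complex.Re (f p) +
      skernel a b c z w p.1 p.2 * Y p * complex.Im (f p) : RT).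
  by move=> mX mY; apply: measurable_funD; apply: measurable_funM => //;
    apply: measurable_funM => //; exact: measurable_funTS.
have mN : measurable_fun setT (fun p => - B p : RT) by exact: measurable_funN.
have [iRe bRe] : mu2.-integrable (TB `*` TB)
      (EFin \o (fun p => complex.Re (K z w p.1 p.2 * f p))) /\
    (`|fine (\int[mu2]_(p in TB `*` TB) (complex.Re (K z w p.1 p.2 * f p))%:E)|%:E
      <= (2 * C)%:E * N)%E.
  apply: (integrable_dominated mT _ _ s2 CN).
    apply: (eq_measurable_fun _ _ (mlin _ _ mA mN)) => p /set_mem pT.
    by rewrite ReE.
  move=> p pT; rewrite ReE//; apply: bound => //; first by case: (AB1 p).
  by rewrite normrN; case: (AB1 p).
have [iIm bIm] : mu2.-integrable (TB `*` TB)
      (EFin \o (fun p => complex.Im (K z w p.1 p.2 * f p))) /\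
    (`|fine (\int[mu2]_(p in TB `*` TB) (complex.Im (K z w p.1 p.2 * f p))%:E)|%:E
      <= (2 * C)%:E * N)%E.
  apply: (integrable_dominated mT _ _ s2 CN).
    apply: (eq_measurable_fun _ _ (mlin _ _ mB mA)) => p /set_mem pT.
    by rewrite ImE.
  by move=> p pT; rewrite ImE//; apply: bound => //; case: (AB1 p).
split; first by split.
rewrite /kop vol2E; apply: le_trans (_ : (_ <= (2 * C)%:E * N + (2 * C)%:E * N)%E) _.
  apply: le_trans (leeD bRe bIm); rewrite -EFinD lee_fin.
  exact: cabs_le_norm.
rewrite NE -!EFinM -EFinD lee_fin; lra.
Qed.

End SufficiencyBounded.

(** * Necessity *)

Section Alignment.
Context {R : realType}.

Lemma cos_small_angle (c : R * R) : exists2 e : R, 0 < e &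
  forall x y : R, `|x| <= e -> `|y| <= e ->
  2^-1 <= cos (c.1 * atan x + c.2 * atan y).
Proof.
have [d /= d0 cosd] : \forall t \near (0 : R), 2^-1 < cos t.
  apply: (cvgr_gt _ (@continuous_cos R 0)); rewrite cos0.
  by rewrite invf_lt1// ltr1n.
(* The summand 1 keeps [M] positive when [c] vanishes and leaves the slack for a strict
   inequality. *)
pose M := `|c.1| + `|c.2| + 1.
have M0 : 0 < M by rewrite ltr_wpDl// addr_ge0.
have [e /= e0 atane] : \forall x \near (0 : R), `|atan x| < d / M.
  apply: (cvgr_norm_lt _ (@continuous_atan R 0)); rewrite atan0 normr0.
  exact: divr_gt0.
exists (e / 2); first exact: divr_gt0.
have small x : `|x| <= e / 2 -> `|atan x| < d / M.
  by move=> xe; apply: atane; rewrite /= sub0r normrN; lra.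
move=> x y /small hx /small hy; apply/ltW/cosd; rewrite /= sub0r normrN.
apply: (le_lt_trans (ler_normD _ _)); rewrite !normrM.
have -> : d = `|c.1| * (d / M) + `|c.2| * (d / M) + d / M.
  by rewrite /M; field; rewrite gt_eqF.
have := ler_wpM2l (normr_ge0 c.1) (ltW hx); have := ler_wpM2l (normr_ge0 c.2) (ltW hy).
by have := divr_gt0 d0 M0; lra.
Qed.

Variable m : nat.
Local Notation RT := (@RT R).
Local Notation Cn := (@Cn R m.+1).
Local Notation TB := (@TB R m.+1).

(* On points with nearly real [rho2] the kernel has no cancellation. *)
Definition aligned_kernel (a b c : R * R) (K : Cn -> Cn -> Cn -> Cn -> R[i]) e :=
  forall z w u eta, TB z -> TB w -> TB u -> TB eta ->
  `|complex.Im (rho2 z u) / complex.Re (rho2 z u)| <= e ->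
  `|complex.Im (rho2 w eta) / complex.Re (rho2 w eta)| <= e ->
  skernel a b c z w u eta / 2 <= complex.Re (K z w u eta).

Lemma aligned_Skernel a b c : aligned_kernel a b c (Skernel a b c) 1.
Proof.
move=> z w u eta _ _ _ _ _ _; rewrite SkernelE /=.
by have := skernel_ge0 a b c z w u eta; lra.
Qed.

Lemma aligned_Tkernel a b c :
  exists2 e, 0 < e & aligned_kernel a b c (Tkernel a b c) e.
Proof.
have [e e0 cose] := cos_small_angle c; exists e => // z w u eta Tz Tw Tu Te h1 h2.
by rewrite TkernelE//= ler_wpM2l ?skernel_ge0//; exact: cose.
Qed.

(** A box centred at the origin with parabolic scaling: widths [sqrt (d * tau)] and [d * tau] make
    every increment in [rho2] of order [d * tau], small against [tau]. *)
Definition test_box (d tau t : R) : set Cn :=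
  tube_box ([::], [::]) (Num.sqrt (d * tau)) (cst 0) (d * tau) t.

Lemma measurable_test_box d tau t : measurable (test_box d tau t).
Proof. by apply: measurable_tube_box; exact: measurable_cst. Qed.

Lemma test_box_TB d tau t : 0 <= t -> test_box d tau t `<=` TB.
Proof. by move=> t0 u /tube_box_rho/andP[tu _]; exact: le_lt_trans tu. Qed.

Lemma vol_test_box d tau t : 0 <= d -> 0 <= tau -> 0 <= t ->
  vol_measure m.+1 (test_box d tau t) =
  ((4 * d) ^+ m * (2 * d) * (tau ^+ m.+1 * t))%:E.
Proof.
move=> d0 tau0 t0.
rewrite [LHS]vol_tube_box ?mulr_ge0 ?sqrtr_ge0//.
rewrite sqr_sqrtr ?mulr_ge0// (_ : 4 * (d * tau) = 4 * d * tau); last by ring.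
rewrite [(4 * d * tau) ^+ m]exprMn exprS; congr EFin; ring.
Qed.

Lemma test_box_coord d tau t (u : Cn) : 0 <= d -> 0 <= tau -> test_box d tau t u ->
  [/\ forall j : 'I_m, `|nth 0 (u.1 : seq R) j| <= Num.sqrt (d * tau),
      forall j : 'I_m, `|nth 0 (u.2 : seq R) j| <= Num.sqrt (d * tau) &
      `|nth 0 (u.1 : seq R) m| <= d * tau].
Proof.
move=> d0 tau0 [[/= hx hm] [/= hy _]]; split.
- by move=> j; have := hx j (ltn_ord j); rewrite nth_nil subr0.
- by move=> j; have := hy j (ltn_ord j); rewrite nth_nil subr0.
- by move: hm; rewrite subr0 ler_norml => /andP[/ltW -> ->].
Qed.

(** The real part is at least [(r + t) / 2 >= tau / 2], while the imaginary part is at most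
    [(2 m + 1) d tau]: a small [d] makes [rho2] nearly real, of size [tau]. *)
Lemma test_box_rho2 (d r t tau : R) (z u : Cn) : 0 < d -> (4 * m%:R + 2) * d <= 1 ->
  0 < r -> 0 < t -> r <= tau -> t <= tau -> tau <= r + t ->
  test_box d r r z -> test_box d tau t u ->
  `|complex.Im (rho2 z u) / complex.Re (rho2 z u)| <= (4 * m%:R + 2) * d /\
  tau <= 4 * cabs (rho2 z u) /\ cabs (rho2 z u) <= 4 * tau.
Proof.
move=> d0 d1 r0 t0 rtau ttau taurt Bz Bu.
have tau0 : 0 < tau by exact: lt_le_trans rtau.
have /andP[z1 z2] := tube_box_rho Bz; have /andP[u1 u2] := tube_box_rho Bu.
have [zx zy zm] := test_box_coord (ltW d0) (ltW r0) Bz.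
have [ux uy um] := test_box_coord (ltW d0) (ltW tau0) Bu.
set h := Num.sqrt (d * tau) in ux uy.
have h0 : 0 <= h by exact: sqrtr_ge0.
have hh : h * h = d * tau by rewrite -expr2 sqr_sqrtr// mulr_ge0// ltW.
have rh : Num.sqrt (d * r) <= h.
  by apply: ler_wsqrtr; rewrite ler_pM2l.
have zx' j := le_trans (zx j) rh; have zy' j := le_trans (zy j) rh.
have drtau : d * r <= d * tau by rewrite ler_pM2l.
have prod4 (p q : R) : `|p| <= 2 * h -> `|q| <= 2 * h -> `|p * q| <= 4 * (d * tau).
  move=> ph qh; rewrite normrM; apply: (le_trans (ler_pM _ _ ph qh)) => //.
  by rewrite mulrACA hh; lra.
have sum4 (F : 'I_m -> R) : (forall j, `|F j| <= 4 * (d * tau)) ->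
    `|\sum_(j < m) F j| <= m%:R * (4 * (d * tau)).
  move=> hF; apply: (le_trans (ler_norm_sum _ _ _)).
  rewrite (_ : m%:R * _ = \sum_(j < m) (4 * (d * tau))).
    by apply: ler_sum => j _.
  by rewrite sumr_const card_ord -[RHS]mulr_natl.
have dB (p q : R) : `|p| <= h -> `|q| <= h -> `|p - q| <= 2 * h.
  by move=> ph qh; apply: (le_trans (ler_normB _ _)); lra.
have dD (p q : R) : `|p| <= h -> `|q| <= h -> `|p + q| <= 2 * h.
  by move=> ph qh; apply: (le_trans (ler_normD _ _)); lra.
have dtau0 : 0 < d * tau by exact: mulr_gt0.
have mdtau : (4 * m%:R + 2) * (d * tau) <= tau.
  by rewrite mulrA ler_piMl// ltW.
have ReL : tau / 2 <= complex.Re (rho2 z u).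
  by apply: le_trans (rho2_Re_ge z u); lra.
have Re0 : 0 < complex.Re (rho2 z u) by apply: lt_le_trans ReL; lra.
have ReU : complex.Re (rho2 z u) <= 3 * tau.
  rewrite rho2_Re.
  have sx := sum4 (fun j => (nth 0 (z.1 : seq R) j - nth 0 (u.1 : seq R) j) ^+ 2)
    (fun j => prod4 _ _ (dB _ _ (zx' j) (ux j)) (dB _ _ (zx' j) (ux j))).
  have sy := sum4 (fun j => (nth 0 (z.2 : seq R) j - nth 0 (u.2 : seq R) j) ^+ 2)
    (fun j => prod4 _ _ (dB _ _ (zy' j) (uy j)) (dB _ _ (zy' j) (uy j))).
  have := le_trans (ler_norm _) sx; have := le_trans (ler_norm _) sy.
  move=> /=; lra.
have ImU : `|complex.Im (rho2 z u)| <= (2 * m%:R + 1) * (d * tau).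
  rewrite rho2_Im.
  have sxy := sum4 (fun j => (nth 0 (z.1 : seq R) j - nth 0 (u.1 : seq R) j) *
      (nth 0 (z.2 : seq R) j + nth 0 (u.2 : seq R) j))
    (fun j => prod4 _ _ (dB _ _ (zx' j) (ux j)) (dD _ _ (zy' j) (uy j))).
  have zu : `|nth 0 (z.1 : seq R) m - nth 0 (u.1 : seq R) m| <= 2 * (d * tau).
    by apply: (le_trans (ler_normB _ _)); lra.
  rewrite normrM ger0_norm ?invr_ge0//.
  by have := le_trans (ler_normB _ _) (lerD sxy zu); lra.
split; [|split].
- rewrite normrM normfV (ger0_norm (ltW Re0)) ler_pdivrMr//.
  apply: (le_trans ImU).
  have pos : 0 <= (4 * m%:R + 2) * d.
    by rewrite mulr_ge0 ?(ltW d0)// addr_ge0// mulr_ge0.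
  by apply: le_trans (ler_wpM2l pos ReL); lra.
- by have := le_trans ReL (le_trans (ler_norm _) (ler_norm_Re_cabs _)); lra.
- apply: (le_trans (cabs_le_norm _)); rewrite (ger0_norm (ltW Re0)); lra.
Qed.

End Alignment.

(** * Testing on unions of boxes *)

Section Necessity.
Context {R : realType} (m : nat).
Local Notation RT := (@RT R).
Local Notation Cn := (@Cn R m.+1).
Local Notation TB := (@TB R m.+1).
Local Notation mu := (@vol_measure R m.+1).
Local Notation mu2 := (@vol2_measure R m.+1).
Variables (a b c alpha : R * R).

(** The factor 1/2 is the loss by alignment; on test boxes each [rho] is known up to a factor 2 and
    each modulus of [rho2] up to a factor 4. *)
Definition kernel_const : R :=
  2^-1 * (2 `^ (- `|a.1|) * 2 `^ (- `|a.2|) * 2 `^ (- `|b.1|) * 2 `^ (- `|b.2|)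
          * (4 `^ (- `|c.1|) * 4 `^ (- `|c.2|))).

Lemma kernel_const_gt0 : 0 < kernel_const.
Proof. by rewrite !mulr_gt0 ?invr_gt0 ?powR_gt0. Qed.

Lemma test_box_skernel (d r1 r2 t s tau sig : R) (z w u eta : Cn) :
  0 < d -> (4 * m%:R + 2) * d <= 1 ->
  0 < r1 -> 0 < t -> r1 <= tau -> t <= tau -> tau <= r1 + t ->
  0 < r2 -> 0 < s -> r2 <= sig -> s <= sig -> sig <= r2 + s ->
  test_box d r1 r1 z -> test_box d r2 r2 w ->
  test_box d tau t u -> test_box d sig s eta ->
  kernel_const * (r1 `^ a.1 * r2 `^ a.2 * t `^ b.1 * s `^ b.2 *
    (tau `^ (- c.1) * sig `^ (- c.2))) <= skernel a b c z w u eta / 2.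
Proof.
move=> d0 d1 r10 t0 h1 h2 h3 r20 s0 h4 h5 h6 Bz Bw Bu Be.
have tau0 : 0 < tau by exact: lt_le_trans h1.
have sig0 : 0 < sig by exact: lt_le_trans h4.
have [_ [zu1 zu2]] := test_box_rho2 d0 d1 r10 t0 h1 h2 h3 Bz Bu.
have [_ [we1 we2]] := test_box_rho2 d0 d1 r20 s0 h4 h5 h6 Bw Be.
have near2 (x y p : R) : 0 < x -> x < y <= 2 * x -> 2 `^ (- `|p|) * x `^ p <= y `^ p.
  move=> x0 /andP[xy yx].
  suff /andP[] : 2 `^ (- `|p|) * x `^ p <= y `^ p <= 2 `^ `|p| * x `^ p by [].
  by apply: powR_near; rewrite ?ler1n//; lra.
have near4 (x y p : R) : 0 < x -> x <= 4 * y -> y <= 4 * x ->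
    4 `^ (- `|p|) * x `^ (- p) <= (y `^ p)^-1.
  move=> x0 xy yx; rewrite -powRN.
  suff /andP[] : 4 `^ (- `|- p|) * x `^ (- p) <= y `^ (- p) <=
    4 `^ `|- p| * x `^ (- p) by rewrite normrN.
  by apply: powR_near; rewrite ?ler1n.
rewrite /skernel invfM /kernel_const.
rewrite ler_pdivlMr//.
have e1 := near2 _ _ a.1 r10 (tube_box_rho Bz).
have e2 := near2 _ _ a.2 r20 (tube_box_rho Bw).
have e3 := near2 _ _ b.1 t0 (tube_box_rho Bu).
have e4 := near2 _ _ b.2 s0 (tube_box_rho Be).
have e5 := near4 _ _ c.1 tau0 zu1 zu2.
have e6 := near4 _ _ c.2 sig0 we1 we2.
have pp (x y : R) p q : 0 <= x `^ p * y `^ q by rewrite mulr_ge0 ?powR_ge0.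
have := ler_pM (mulr_ge0 (mulr_ge0 (mulr_ge0 (pp _ _ _ _) (pp _ _ _ _)) (pp _ _ _ _))
    (pp _ _ _ _)) (mulr_ge0 (pp _ _ _ _) (pp _ _ _ _))
  (ler_pM (mulr_ge0 (mulr_ge0 (pp _ _ _ _) (pp _ _ _ _)) (pp _ _ _ _)) (pp _ _ _ _)
    (ler_pM (mulr_ge0 (pp _ _ _ _) (pp _ _ _ _)) (pp _ _ _ _)
      (ler_pM (pp _ _ _ _) (pp _ _ _ _) e1 e2) e3) e4)
  (ler_pM (pp _ _ _ _) (pp _ _ _ _) e5 e6).
by apply: le_trans; rewrite le_eqVlt; apply/orP; left; apply/eqP; field.
Qed.

(* The test function is the indicator of a union of boxes in [u], of heights
   [2 ^ k * t0], times a box in [eta]. *)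
Lemma testing_inequality (K : Cn -> Cn -> Cn -> Cn -> R[i]) (e : R) : 0 < e ->
  aligned_kernel a b c K e -> bounded_inf1_to_inf m.+1 alpha K ->
  exists C : R, forall (r1 r2 s t0 : R) (n : nat),
  0 < r1 -> 0 < r2 -> 0 < s -> 0 < t0 ->
  r1 `^ a.1 * r2 `^ a.2 * s `^ b.2 * Num.max r2 s `^ (- c.2) *
    (\sum_(k < n) ((2 ^+ k * t0) `^ b.1 * (2 ^+ k * t0) *
       Num.max r1 (2 ^+ k * t0) `^ (- c.1) * Num.max r1 (2 ^+ k * t0) ^+ m.+1))
  <= C * s `^ alpha.2.
Proof.
move=> e0 alK [C bK].
pose M : R := 4 * m%:R + 2; have M0 : 0 < M by rewrite ltr_wpDl// mulr_ge0.
(* Then [M * d] is at most 1, as the box estimates require, and at most [e], as alignment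
   requires. *)
pose d : R := Num.min 1 e / M.
have d0 : 0 < d by rewrite divr_gt0// lt_min ltr01.
have Md : M * d = Num.min 1 e by rewrite mulrC divfK// gt_eqF.
have d1 : M * d <= 1 by rewrite Md ge_min lexx.
have de : M * d <= e by rewrite Md ge_min lexx orbT.
pose kap' : R := (4 * d) ^+ m * (2 * d).
have kap'0 : 0 < kap' by apply: mulr_gt0; [apply: exprn_gt0|]; apply: mulr_gt0.
have kap0 := kernel_const_gt0.
exists ((`|C| + 1) * 2 `^ `|alpha.2| / (kernel_const * kap')).
move=> r1 r2 s t0 n r10 r20 s0 t00.
pose t k : R := 2 ^+ k * t0; pose tau k := Num.max r1 (t k).
pose sig := Num.max r2 s.
have tk0 k : 0 < t k by rewrite mulr_gt0// exprn_gt0.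
have max_le (x y : R) : 0 < x -> 0 < y ->
    [/\ 0 < Num.max x y, x <= Num.max x y, y <= Num.max x y & Num.max x y <= x + y].
  move=> x0 y0; rewrite !le_max !lexx orbT lt_max x0; split=> //.
  by rewrite ge_max; apply/andP; split; lra.
have [tau0 rt tt trt] : [/\ forall k, 0 < tau k, forall k, r1 <= tau k,
    forall k, t k <= tau k & forall k, tau k <= r1 + t k].
  by split=> k; have [] := max_le _ _ r10 (tk0 k).
have [sig0 rs ss srs] := max_le _ _ r20 s0; rewrite -/sig in sig0 rs ss srs.
pose G k : set Cn := test_box d (tau k) (t k).
pose H : set Cn := test_box d sig s.
pose Z : set Cn := test_box d r1 r1.
pose W : set Cn := test_box d r2 r2.
have mtb x y : measurable (test_box d x y : set Cn) by exact: measurable_test_box.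
have GT k : G k `<=` TB by apply: test_box_TB; exact: ltW.
have HT : H `<=` TB by apply: test_box_TB; exact: ltW.
have ZT : Z `<=` TB by apply: test_box_TB; exact: ltW.
have WT : W `<=` TB by apply: test_box_TB; exact: ltW.
(* The height ranges []t k, 2 * t k]] are disjoint, so at a point of [S] a single term of the sum
   over [k] survives. *)
have Guniq j k u : G j u -> G k u -> j = k.
  move=> /tube_box_rho/andP[j1 j2] /tube_box_rho/andP[k1 k2].
  have lt_t (p q : nat) : t p < 2 * t q -> (p <= q)%N.
    by rewrite /t mulrA -exprS ltr_pM2r// ltr_eXn2l ?ltr1n.
  by apply/eqP; rewrite eqn_leq; apply/andP; split; apply: lt_t;
    [exact: lt_le_trans j1 k2|exact: lt_le_trans k1 j2].
pose S : set (Cn * Cn) := (\bigcup_(k in `I_n) G k) `*` H.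
have mS : measurable S.
  by apply: measurableX; [apply: bigcup_measurable => k _|]; exact: mtb.
pose f (p : Cn * Cn) : R[i] := Complex (\1_S p) 0.
have mf1 : measurable_fun (TB `*` TB) (fun p => complex.Re (f p) : RT).
  exact: measurable_indic.
have mf2 : measurable_fun (TB `*` TB) (fun p => complex.Im (f p) : RT).
  exact: measurable_cst.
pose vH : R := kap' * (sig ^+ m.+1 * s).
have vH0 : 0 < vH.
  by apply: mulr_gt0 => //; apply: mulr_gt0 => //; apply: exprn_gt0.
have muH : mu H = vH%:E by rewrite /H vol_test_box// ltW.
pose N : R := 2 `^ `|alpha.2| * s `^ alpha.2 * vH.
have N0 : 0 < N by apply: mulr_gt0 => //; apply: mulr_gt0; exact: powR_gt0.
have fN : (mixnorm_inf1 m.+1 alpha f <= N%:E)%E.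
  rewrite /mixnorm_inf1 volE.
  apply: (@le_trans _ _ (\int[mu]_(w in TB)
      ((2 `^ `|alpha.2| * s `^ alpha.2)%:E * (\1_H w)%:E))%E); last first.
    have mI : measurable_fun TB (fun w => (\1_H w : R)%:E).
      by apply/measurable_EFinP; apply: measurable_indic; exact: mtb.
    rewrite (ge0_integralZl mu (@measurable_TB R m) mI); last 2 first.
    - by move=> w _; rewrite lee_fin.
    - by rewrite lee_fin mulr_ge0 ?powR_ge0.
    rewrite integral_indic; [|exact: measurable_TB|exact: mtb].
    by rewrite (setIidl HT) [X in (_ * X <= _)%E]muH -EFinM.
  apply: ge0_le_lower_integral => w Tw.
    by rewrite mule_ge0 ?lee_fin ?powR_ge0//; apply: ess_sup_on_ge0 => u; exact: cabs_ge0.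
  (* The supremum in the first variable does not grow with the number [n] of boxes, whereas the
     integral against the kernel adds them up. *)
  have esH : (ess_sup_on (volw m.+1 alpha.1) TB (fun z => cabs (f (z, w))) <=
      (\1_H w)%:E)%E.
    apply: ereal_inf_lbound => /=; exists set0; split => //.
      by rewrite /volw set0I volE integral_set0.
    move=> z /= [_]; rewrite lte_fin ltNge => /negP; apply.
    rewrite /cabs /f /= expr0n addr0 sqrtr_sqr ger0_norm// !indicE ler_nat.
    by case: (boolP ((z, w) \in S)) => // /set_mem [_ /= Hw]; rewrite mem_set.
  apply: (le_trans (lee_wpmul2r _ esH)); first by rewrite lee_fin powR_ge0.
  rewrite -!EFinM lee_fin [leRHS]mulrC indicE.
  case: (boolP (w \in H)) => [/set_mem/tube_box_rho/andP[w1 w2]|_]; last by rewrite !mul0r.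
  rewrite !mul1r.
  suff /andP[] : 2 `^ (- `|alpha.2|) * s `^ alpha.2 <= rho w `^ alpha.2 <=
    2 `^ `|alpha.2| * s `^ alpha.2 by [].
  by apply: powR_near; rewrite ?ler1n//; lra.
have nf0 : (0 <= mixnorm_inf1 m.+1 alpha f)%E.
  rewrite /mixnorm_inf1 volE; apply: integral_ge0 => w _.
  by rewrite mule_ge0 ?lee_fin ?powR_ge0//; apply: ess_sup_on_ge0 => u; exact: cabs_ge0.
have [nint ess] := bK f mf1 mf2 (le_lt_trans fN (ltry _)).
rewrite vol2E in nint ess.
(* [C] may be negative, and a strict bound is needed to pick an essential bound [y] below it. *)
have : (ess_sup_on mu2 (TB `*` TB) (fun zw => cabs (kop K f zw)) <
    ((`|C| + 1) * N)%:E)%E.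
  apply: (le_lt_trans ess); apply: (@le_lt_trans _ _ (`|C| * N)%:E).
    rewrite EFinM; apply: (@le_trans _ _ (`|C|%:E * mixnorm_inf1 m.+1 alpha f)%E).
      by apply: lee_wpmul2r => //; rewrite lee_fin ler_norm.
    by apply: lee_wpmul2l => //; rewrite lee_fin.
  by rewrite lte_fin mulrDl mul1r ltrDl.
move=> /ereal_inf_lt [y /= ny yN].
have mZW : measurable (Z `*` W) by apply: measurableX; exact: mtb.
(* [Z] times [W] has positive measure, so it is not covered by the two null exceptional sets. *)
have [[z w] [/= Zz Ww] [good1 good2]] : exists2 zw, (Z `*` W) zw &
    cintegrable mu2 (TB `*` TB) (fun ue => K zw.1 zw.2 ue.1 ue.2 * f ue) /\
    ((cabs (kop K f zw))%:E <= y)%E.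
  apply: contrapT => none.
  have : mu2.-negligible (Z `*` W).
    have := negligibleU nint ny; apply: negligibleS => zw ZW.
    have Tzw : (TB `*` TB) zw by case: ZW => z1 w1; split; [exact: ZT|exact: WT].
    apply: contrapT => nb; apply: none; exists zw => //; split.
      by apply: contrapT => ni; apply: nb; left.
    by rewrite leNgt; apply/negP => ly; apply: nb; right.
  move=> /(measure_negligible mZW); rewrite [LHS]product_measure1E; [|exact: mtb..].
  have muB r : 0 < r -> mu (test_box d r r) = (kap' * (r ^+ m.+1 * r))%:E.
    by move=> r0; rewrite vol_test_box// ltW.
  rewrite [X in (X * _)%E = _](muB _ r10) [X in (_ * X)%E = _](muB _ r20).
  rewrite -EFinM => -[] /eqP.
  have pos r : 0 < r -> 0 < kap' * (r ^+ m.+1 * r).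
    by move=> r0; apply: mulr_gt0 => //; apply: mulr_gt0 => //; apply: exprn_gt0.
  by rewrite mulf_eq0 !gt_eqF// pos.
have mT : measurable (TB `*` TB) by apply: measurableX; exact: measurable_TB.
have Tz := ZT _ Zz; have Tw := WT _ Ww.
have [iRe _] := good1.
pose g p := complex.Re (K z w p.1 p.2 * f p).
have gfin : (\int[mu2]_(p in TB `*` TB) (g p)%:E)%E \is a fin_num.
  exact: integrable_fin_num iRe.
have upper : (\int[mu2]_(p in TB `*` TB) (g p)%:E <= ((`|C| + 1) * N)%:E)%E.
  rewrite -(fineK gfin); apply: le_trans (ltW yN); apply: le_trans good2.
  rewrite lee_fin; apply: le_trans (ler_norm_Re_cabs _).
  by rewrite /kop vol2E; exact: ler_norm.
pose M_ k : R := kernel_const * (r1 `^ a.1 * r2 `^ a.2 * t k `^ b.1 * s `^ b.2 *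
    (tau k `^ (- c.1) * sig `^ (- c.2))).
have M_0 k : 0 <= M_ k.
  by apply: mulr_ge0; [exact: ltW|rewrite !mulr_ge0 ?powR_ge0].
pose vG k : R := kap' * (tau k ^+ m.+1 * t k).
have lower : ((\sum_(k < n) M_ k * (vG k * vH))%:E <=
    \int[mu2]_(p in TB `*` TB) (g p)%:E)%E.
  have mGH k : measurable (G k `*` H) by apply: measurableX; exact: mtb.
  apply: (@le_trans _ _ (\int[mu2]_(p in TB `*` TB)
      \sum_(k < n) ((M_ k)%:E * (\1_(G k `*` H) p)%:E))%E).
    have mI k : measurable_fun (TB `*` TB) (fun p => (\1_(G k `*` H) p : R)%:E).
      by apply/measurable_EFinP; exact: measurable_indic.
    rewrite ge0_integral_sum//; last 2 first.
    - by move=> k; apply: emeasurable_funM => //; exact: measurable_cst.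
    - by move=> k p _; rewrite mule_ge0 ?lee_fin.
    rewrite -sumEFin lee_sum// => k _.
    rewrite (ge0_integralZl mu2 mT (mI k)); last 2 first.
    - by move=> p _; rewrite lee_fin.
    - by rewrite lee_fin.
    rewrite integral_indic// (setIidl _); last first.
      by move=> p [p1 p2]; split; [exact: GT p1|exact: HT p2].
    rewrite [X in (_ <= _ * X)%E]product_measure1E; [|exact: mtb..].
    rewrite [X in (_ <= _ * (_ * X))%E]muH [X in (_ <= _ * (X * _))%E]vol_test_box;
      [|exact: ltW..].
    by rewrite -!EFinM.
  apply: ge0_le_lower_integral => p [Tu Te].
    by apply: sume_ge0 => k _; rewrite mule_ge0 ?lee_fin.
  rewrite (eq_bigr (fun k : 'I_n => (M_ k * \1_(G k `*` H) p)%:E)); last first.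
    by move=> k _; rewrite EFinM.
  rewrite sumEFin lee_fin /g Re_mul /f /= mulr0 subr0.
  have [[[k /= kn Gk] He]|nS] := pselect (S p); last first.
    rewrite indicE memNset// mulr0 big1// => k _.
    rewrite indicE memNset ?mulr0// => -[Gk Hp].
    by apply: nS; split => //; exists k => //=.
  rewrite indicE mem_set//; last by split => //; exists k.
  rewrite mulr1 (bigD1 (Ordinal kn))//= big1 ?addr0; last first.
    move=> j jk; rewrite indicE memNset ?mulr0// => -[Gj _].
    by move/negP: jk; apply; apply/eqP/val_inj => /=; exact: (Guniq _ _ _ Gj Gk).
  rewrite indicE mem_set ?mulr1//.
  have ang1 := test_box_rho2 d0 d1 r10 (tk0 k) (rt k) (tt k) (trt k) Zz Gk.
  have ang2 := test_box_rho2 d0 d1 r20 s0 rs ss srs Ww He.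
  apply: le_trans (alK z w p.1 p.2 Tz Tw Tu Te (le_trans ang1.1 de) (le_trans ang2.1 de)).
  exact: (test_box_skernel d0 d1 r10 (tk0 k) (rt k) (tt k) (trt k)).
have := le_trans lower upper; rewrite lee_fin.
rewrite (_ : \sum_(k < n) _ = kernel_const * kap' * vH * (r1 `^ a.1 * r2 `^ a.2 *
    s `^ b.2 * sig `^ (- c.2) * (\sum_(k < n) (t k `^ b.1 * t k *
       tau k `^ (- c.1) * tau k ^+ m.+1)))); last first.
  rewrite !mulr_sumr; apply: eq_bigr => k _; rewrite /M_ /vG.
  set X := tau k ^+ m.+1; ring.
rewrite /N (_ : (_ + 1) * _ = vH * ((`|C| + 1) * 2 `^ `|alpha.2| * s `^ alpha.2));
  last by ring.
set LHS := r1 `^ _ * _ * _ * _ * _.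
(* The volume of [H] occurs on both sides and cancels. *)
rewrite mulrAC [_ * vH]mulrC -mulrA ler_pM2l// => main.
have kk0 := mulr_gt0 kap0 kap'0.
rewrite [leRHS]mulrAC ler_pdivlMr//.
by rewrite mulrC -[leRHS]mulrA.
Qed.

End Necessity.

(** * Exponent conditions from the testing inequality *)

Lemma necessary_conditions {R : realType} (m : nat) (a b c alpha : R * R)
    (K : Cn m.+1 -> Cn m.+1 -> Cn m.+1 -> Cn m.+1 -> R[i]) (e : R) : 0 < e ->
  aligned_kernel a b c K e -> bounded_inf1_to_inf m.+1 alpha K ->
  0 < a.1 /\ 0 <= a.2 /\ -1 < b.1 /\ alpha.2 <= b.2 /\
  c.1 = m.+1%:R + 1 + a.1 + b.1 /\ c.2 = a.2 + b.2 - alpha.2.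
Proof.
move=> e0 alK bK; have [C main] := testing_inequality e0 alK bK.
have one1 p : (1 : R) `^ p = 1 by rewrite powR1.
(* Homogeneity in the first variables: with [r1 = t0 = x] a pure power of [x] stays bounded on all
   of [(0, oo)], so its exponent is 0. *)
have e1 : a.1 + b.1 + 1 + m.+1%:R - c.1 = 0.
  have h x : 0 < x -> x `^ (a.1 + b.1 + 1 + m.+1%:R - c.1) <= C.
    move=> x0; have := main x 1 1 x 1%N x0 ltr01 ltr01 x0.
    rewrite big_ord_recl big_ord0 addr0 expr0 !mul1r !maxxx !one1 !mulr1.
    apply: le_trans; rewrite !powRD_gt0// (powRr1 (ltW x0)) (powR_mulrn _ (ltW x0)).
    by rewrite le_eqVlt; apply/orP; left; apply/eqP; set X := x ^+ _; ring.
  apply/eqP; rewrite eq_le; apply/andP; split.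
    by apply: (@powR_bounded_ge1 _ _ C) => x x1; apply: h; exact: lt_le_trans x1.
  by apply: (@powR_bounded_le1 _ _ C) => x /andP[x0 _]; exact: h.
have h2 x y : 0 < x -> 0 < y ->
    x `^ a.2 * y `^ (b.2 - alpha.2) * Num.max x y `^ (- c.2) <= C.
  move=> x0 y0; have := main 1 x y 1 1%N ltr01 x0 y0 ltr01.
  rewrite big_ord_recl big_ord0 addr0 expr0 !mul1r !maxxx !one1 expr1n !mulr1.
  rewrite -ler_pdivrMr ?powR_gt0//; apply: le_trans.
  rewrite powRD_gt0// [y `^ (- _)]powRN.
  by rewrite le_eqVlt; apply/orP; left; apply/eqP; ring.
(* The same scaling in the second variables, on the diagonal [x = y] of [h2]. *)
have e2 : a.2 + b.2 - alpha.2 - c.2 = 0.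
  have h x : 0 < x -> x `^ (a.2 + b.2 - alpha.2 - c.2) <= C.
    move=> x0; have := h2 x x x0 x0; rewrite maxxx -!powRD_gt0//.
    by apply: le_trans; rewrite le_eqVlt; apply/orP; left; apply/eqP;
      congr (_ `^ _); ring.
  apply/eqP; rewrite eq_le; apply/andP; split.
    by apply: (@powR_bounded_ge1 _ _ C) => x x1; apply: h; exact: lt_le_trans x1.
  by apply: (@powR_bounded_le1 _ _ C) => x /andP[x0 _]; exact: h.
(* Height 1 for [w] and height [x] tending to 0 for [eta]. *)
have b2 : 0 <= b.2 - alpha.2.
  apply: (@powR_bounded_le1 _ _ C) => x /andP[x0 x1].
  have := h2 1 x ltr01 x0; rewrite (max_idPl x1) !one1 mul1r mulr1.
  by [].
(* Now [x] tends to infinity; by [e2] this exponent is [- a.2]. *)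
have a2 : b.2 - alpha.2 - c.2 <= 0.
  apply: (@powR_bounded_ge1 _ _ C) => x x1; have x0 := lt_le_trans ltr01 x1.
  have := h2 1 x ltr01 x0; rewrite (max_idPr x1) !one1 mul1r -powRD_gt0//.
have notnat (r : R) : (forall n : nat, n%:R <= r) -> False.
  move=> hr; have := hr (Num.bound r).+1; apply/negP; rewrite -ltNge.
  have r0 : 0 <= r by exact: (hr 0%N).
  by apply: (lt_le_trans (archi_boundP r0)); rewrite ler_nat.
(* At heights [2 ^ k] above [r1 = 1] the terms are powers with exponent [- a.1]. If [a.1 <= 0], each
   is at least 1, and the sum of [n] of them is unbounded. *)
have a1 : 0 < a.1.
  rewrite ltNge; apply/negP => a10; apply: (notnat C) => n.
  have := main 1 1 1 1 n ltr01 ltr01 ltr01 ltr01.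
  rewrite maxxx !one1 !mul1r !mulr1; apply: le_trans.
  rewrite -[n%:R]mulr_natl mulr1 -[X in X%:R](card_ord n) -sumr_const.
  apply: ler_sum => k _; rewrite mulr1.
  have k1 : 1 <= 2 ^+ k :> R by rewrite exprn_ege1// ler1n.
  have k0 : 0 < 2 ^+ k :> R by rewrite exprn_gt0.
  rewrite (max_idPr k1) -{2}[2 ^+ k](powRr1 (ltW k0)) -(powR_mulrn _ (ltW k0)).
  rewrite -!powRD_gt0// -[leLHS](powRr0 (2 ^+ k)); apply: ler_powR => //; lra.
(* Starting at [t0 = 2 ^ (- n)] keeps all [n] heights below [r1 = 1]; the terms are [t ^ (b.1 + 1)],
   each at least 1 if [b.1 <= -1]. *)
have b1 : -1 < b.1.
  rewrite ltNge; apply/negP => b10; apply: (notnat C) => n.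
  have t0 : 0 < (2 ^+ n)^-1 :> R by rewrite invr_gt0 exprn_gt0.
  have := main 1 1 1 (2 ^+ n)^-1 n ltr01 ltr01 ltr01 t0.
  rewrite maxxx !one1 !mul1r !mulr1; apply: le_trans.
  rewrite -[n%:R]mulr_natl mulr1 -[X in X%:R](card_ord n) -sumr_const.
  apply: ler_sum => k _; set t := 2 ^+ k * _.
  have tt0 : 0 < t by rewrite mulr_gt0// exprn_gt0.
  have t1 : t <= 1.
    by rewrite ler_pdivrMr ?exprn_gt0// mul1r ler_eXn2l ?ltr1n// ltnW.
  rewrite (max_idPl t1) one1 expr1n !mulr1 -{2}[t](powRr1 (ltW tt0)) -powRD_gt0//.
  rewrite -[leLHS](powRr0 t); apply: ger_powR; [by rewrite tt0|lra].
split => //; split; first by lra.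
split => //; split; first by lra.
by split; lra.
Qed.

Theorem theorem6p11 (R : realType) (n : nat) (a b c alpha : R * R) :
  (0 < n)%N -> -1 < alpha.1 -> -1 < alpha.2 ->
  (bounded_inf1_to_inf n alpha (Skernel a b c) <->
   bounded_inf1_to_inf n alpha (Tkernel a b c)) /\
  (bounded_inf1_to_inf n alpha (Tkernel a b c) <->
   (0 < a.1 /\ 0 <= a.2 /\ -1 < b.1 /\ alpha.2 <= b.2 /\
    c.1 = n%:R + 1 + a.1 + b.1 /\ c.2 = a.2 + b.2 - alpha.2)).
Proof.
case: n => [//|m] _ _ _.
have necS := necessary_conditions ltr01 (@aligned_Skernel R m a b c) (alpha := alpha).
have [e e0 alT] := @aligned_Tkernel R m a b c.
have necT := necessary_conditions e0 alT (alpha := alpha).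
have bounded (K : Cn m.+1 -> Cn m.+1 -> Cn m.+1 -> Cn m.+1 -> R[i]) :
    phase_kernel a b c K ->
    0 < a.1 /\ 0 <= a.2 /\ -1 < b.1 /\ alpha.2 <= b.2 /\
    c.1 = m.+1%:R + 1 + a.1 + b.1 /\ c.2 = a.2 + b.2 - alpha.2 ->
    bounded_inf1_to_inf m.+1 alpha K.
  move=> phK [a1 [a2 [b1 [b2 [c1 c2]]]]].
  exact: (bounded_of_phase_kernel a1 a2 b1 b2 c1 c2 phK).
have bS := bounded _ (@phase_Skernel R m a b c).
have bT := bounded _ (@phase_Tkernel R m a b c).
(* Boundedness passes from one operator to the other through the exponent conditions. *)
split; split.
- exact: (fun h => bT (necS h)).
- exact: (fun h => bS (necT h)).
- exact: necT.
- exact: bT.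
Qed.
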